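(* Suppose that the local exactness condition and the geometric decomposition condition hold, and that $\mathcal T$ satisfies the local patch condition relative to $\mathcal U$. Then for every $0\le k\le n$ there are isomorphisms of vector spaces $$\mathcal H_{n-k}(\mathcal T,\mathcal U)\simeq\mathfrak C^0(\mathcal T^{n-k})\simeq\mathfrak H^k(\mathcal T^n).$$
   Context: Simplices. Fix $n\in\mathbb N_0$. Simplices are closed simplices in $\mathbb R^n$. $F\trianglelefteq C$ means that $F$ is a subsimplex of $C$ (the vertices of $F$ are among those of $C$); $F\vartriangleleft C$ means $F\trianglelefteq C$ and $F\ne C$. A simplicial complex is a set of simplices that contains all subsimplices of its members and in which every nonempty intersection of two members is a subsimplex of both. It is $p$-dimensional if each member is a subsimplex of some $p$-dimensional member. $\mathcal T$ is a finite $n$-dimensional simplicial complex and $\mathcal U\subseteq\mathcal T$ is a (possibly empty) simplicial subcomplex. $\mathcal T^m,\mathcal U^m$ denote the sets of $m$-dimensional members (empty if there are none). For a complex $\mathcal M$, $\mathcal M^{[m]}$ is its largest $m$-dimensional subcomplex ($m$-skeleton). All simplices carry a fixed orientation (the Euclidean one for $n$-simplices); for a codimension-one subsimplex $F$ of $C$, $o(F,C)=1$ if the orientation induced by $C$ on $F$ is that of $F$, and $o(F,C)=-1$ otherwise. $\mathcal C_m(\mathcal T)$ is the real vector space with basis $\mathcal T^m$, with boundary $\partial_m C=\sum_{F\in\mathcal T^{m-1},F\vartriangleleft C}o(F,C)F$; $\mathcal C_m(\mathcal T,\mathcal U)=\mathcal C_m(\mathcal T)/\mathcal C_m(\mathcal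 U)$ with induced boundary, and $\mathcal H_m(\mathcal T,\mathcal U)$ is the $m$-th homology space of this relative chain complex (real coefficients). Spaces of forms. For each $C\in\mathcal T$ and each $k$ there is a given finite-dimensional subspace $\Lambda^k(C)$ of the space of smooth $k$-forms on $C$ (smooth up to the boundary), with $\Lambda^k(C)=0$ for $k<0$ or $k>\dim C$, such that the exterior derivative $\mathsf d_C^k$ maps $\Lambda^k(C)$ into $\Lambda^{k+1}(C)$ and such that for $F\trianglelefteq C$ the trace $\operatorname{tr}^k_{C,F}$ (pullback along the inclusion $F\subseteq C$) satisfies $\operatorname{tr}^k_{C,F}\Lambda^k(C)=\Lambda^k(F)$. Put $\Lambda^k_{-1}(\mathcal T^m)=\bigoplus_{C\in\mathcal T^m\setminus\mathcal U^m}\Lambda^k(C)$; the component of $\omega$ at $C$ is $\omega_C$. Define $\mathsf D^m_k:\Lambda^k_{-1}(\mathcal T^m)\to\Lambda^{k+1}_{-1}(\mathcal T^m)$, $\mathsf D^m_k\omega=\sum_{C}\mathsf d^k_C\omega_C$, and $\mathsf T^m_k:\Lambda^k_{-1}(\mathcal T^m)\to\Lambda^k_{-1}(\mathcal T^{m-1})$, $\mathsf T^m_k\omega=\sum_{C\in\mathcal T^m\setminus\mathcal U^m}\sum_{F\in\mathcal T^{m-1}\setminus\mathcal U^{m-1},F\vartriangleleft C}o(F,C)\operatorname{tr}^k_{C,F}\omega_C$. Put $\Lambda^k(\mathcal T^m)=\ker\mathsf T^m_k$ and $\Gamma^k(\mathcal T^m)=\ker\mathsf D^m_k$. Each $\Lambda^k_{-1}(\mathcal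 T^m)$ carries a fixed (arbitrary) scalar product. Harmonic spaces: $\mathfrak H^k(\mathcal T^n)=\{\omega\in\Lambda^k(\mathcal T^n): \mathsf D^n_k\omega=0,\ \omega\perp\mathsf D^n_{k-1}\Lambda^{k-1}(\mathcal T^n)\}$, $\mathfrak C^0(\mathcal T^m)=\{\omega\in\Gamma^0(\mathcal T^m):\mathsf T^m_0\omega=0,\ \omega\perp\mathsf T^{m+1}_0\Gamma^0(\mathcal T^{m+1})\}$. Conditions. Local exactness condition: for each $C\in\mathcal T\setminus\mathcal U$ of dimension $m$, the sequence $0\to\ker\mathsf d^0_C\to\Lambda^0(C)\to\dots\to\Lambda^m(C)\to0$ (with the maps $\mathsf d^k_C$) is exact and $\ker\mathsf d^0_C$ is spanned by the constant function $1_C$. Geometric decomposition condition: with $\mathring\Lambda^k(F)=\{\omega\in\Lambda^k(F):\operatorname{tr}^k_{F,G}\omega=0\ \forall G\vartriangleleft F\}$, there are linear maps $\operatorname{ext}^k_{F,C}:\mathring\Lambda^k(F)\to\Lambda^k(C)$ for all $F\trianglelefteq C$ in $\mathcal T$ with $\operatorname{tr}^k_{C,F}\operatorname{ext}^k_{F,C}=\mathrm{Id}$, $\operatorname{ext}^k_{F,G}=\operatorname{tr}^k_{C,G}\operatorname{ext}^k_{F,C}$ for $F\trianglelefteq G\trianglelefteq C$, and $\operatorname{tr}^k_{C,G}\operatorname{ext}^k_{F,C}=0$ for $G\trianglelefteq C$ with $F\not\trianglelefteq G$. Local patch condition of $\mathcal T$ relative to $\mathcal U$: for all $F\in\mathcal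 T$, with $\mathcal M_F=\{G\in\mathcal T:\exists C\in\mathcal T^n, F\trianglelefteq C, G\trianglelefteq C\}$ and $\mathcal N_F=\{G\in\mathcal M_F^{[n-1]}:F\not\trianglelefteq G\text{ or }G\in\mathcal U\}$, the relative simplicial chain complex $\mathcal C_\bullet(\mathcal M_F,\mathcal N_F)$ has vanishing homology in degrees $0,\dots,n-1$. *)

(* Defs.v *)
From HB Require Import structures.
From mathcomp Require Import all_boot all_order all_algebra.
From mathcomp Require Import finmap generic_quotient.
From mathcomp Require Import all_classical all_reals all_analysis.

Set Implicit Arguments.
Unset Strict Implicit.
Unset Printing Implicit Defensive.

Import Order.TTheory GRing.Theory Num.Theory.
Import numFieldNormedType.Exports.

Local Open Scope classical_set_scope.
Local Open Scope ring_scope.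

Definition lspan (R : nzRingType) (V : lmodType R) (S : set V) : set V :=
  [set v | exists m (c : 'I_m -> R) (s : 'I_m -> V),
     (forall i, S (s i)) /\ v = \sum_(i < m) c i *: s i].

Definition findim_subspace (R : nzRingType) (V : lmodType R) (A : set V) :=
  exists e : seq V, A = lspan [set` e].

(** Isomorphism between subspaces [A] and [B] of two ambient spaces. *)
Definition lin_iso (R : nzRingType) (V W : lmodType R) (A : set V) (B : set W) :=
  exists f : V -> W,
    (forall a u v, A u -> A v -> f (a *: u + v) = a *: f u + f v) /\
    set_bij A B f.

Definition scalar_product (R : realType) (V : lmodType R) (A : set V)
    (ip : V -> V -> R) :=
  [/\ forall a u v w, A u -> A v -> A w ->
        ip (a *: u + v) w = a * ip u w + ip v w,
      forall u v, A u -> A v -> ip u v = ip v u &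
      forall u, A u -> u != 0 -> 0 < ip u u].

(** The quotient of [V] by the subspace spanned by [S].  In all uses below [S]
    is itself a subspace, so this is just V/S; taking the span makes the
    construction total. *)
Section Quotient.
Variables (R : nzRingType) (V : lmodType R) (S : set V).

Lemma lspan0 : lspan S 0.
Proof.
exists 0%N, (fun=> 0), (fun=> 0); split; first by case.
by rewrite big_ord0.
Qed.

Lemma lspanZ a u : lspan S u -> lspan S (a *: u).
Proof.
move=> [m [c [s [Ss ->]]]]; exists m, (fun i => a * c i), s; split=> //.
by rewrite scaler_sumr; apply: eq_bigr => i _; rewrite scalerA.
Qed.

Lemma lspanD u v : lspan S u -> lspan S v -> lspan S (u + v).
Proof.
move=> [m [c [s [Ss ->]]]] [m' [c' [s' [Ss' ->]]]].
exists (m + m')%N,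
  (fun i => match fintype.split i with inl j => c j | inr j => c' j end),
  (fun i => match fintype.split i with inl j => s j | inr j => s' j end).
split; first by move=> i; case: (fintype.split i).
rewrite big_split_ord /=; congr (_ + _); apply: eq_bigr => i _.
- by rewrite (unsplitK (inl i)).
- by rewrite (unsplitK (inr i)).
Qed.

Definition quot_rel (u v : V) : bool := `[< lspan S (u - v) >].

Lemma quot_rel_equiv : equiv_class_of quot_rel.
Proof.
split.
- by move=> u; apply/asboolP; rewrite subrr; exact: lspan0.
- by move=> u v; apply/idP/idP => /asboolP /(lspanZ (-1)) h; apply/asboolP;
    move: h; rewrite scaleN1r opprB.
- move=> v u w /asboolP uv /asboolP vw; apply/asboolP.
  by rewrite -(subrKA v); exact: lspanD.
Qed.

Canonical quot_equiv := EquivRelPack quot_rel_equiv.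

Definition quot : Type := {eq_quot quot_equiv}%qT.
HB.instance Definition _ := Choice.on quot.
HB.instance Definition _ := EqQuotient.on quot.

Definition qpi (u : V) : quot := (\pi_quot u)%qT.

Lemma qpiE u v : (qpi u = qpi v) <-> lspan S (u - v).
Proof.
by split=> [/eqP|h]; [rewrite /qpi piE => /asboolP|
  apply/eqP; rewrite /qpi piE; apply/asboolP].
Qed.

Definition quot_zero : quot := qpi 0.
Definition quot_opp (x : quot) : quot := qpi (- repr x).
Definition quot_add (x y : quot) : quot := qpi (repr x + repr y).
Definition quot_scale (a : R) (x : quot) : quot := qpi (a *: repr x).

Lemma qpi_repr (x : quot) : qpi (repr x) = x.
Proof. exact: reprK. Qed.

Lemma repr_qpi u : lspan S (repr (qpi u) - u).
Proof. by apply/qpiE; rewrite qpi_repr. Qed.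

Lemma qpi_opp u : quot_opp (qpi u) = qpi (- u).
Proof.
by apply/qpiE; have := lspanZ (-1) (repr_qpi u); rewrite scaleN1r opprD.
Qed.

Lemma qpi_add u v : quot_add (qpi u) (qpi v) = qpi (u + v).
Proof.
by apply/qpiE; rewrite opprD addrACA; apply: lspanD; exact: repr_qpi.
Qed.

Lemma qpi_scale a u : quot_scale a (qpi u) = qpi (a *: u).
Proof. by apply/qpiE; rewrite -scalerBr; apply: lspanZ; exact: repr_qpi. Qed.

Lemma qpi_ind (P : quot -> Prop) : (forall u, P (qpi u)) -> forall x, P x.
Proof. by move=> h x; rewrite -(qpi_repr x). Qed.

Lemma quot_addA : associative quot_add.
Proof.
elim/qpi_ind=> u; elim/qpi_ind=> v; elim/qpi_ind=> w.
by rewrite !qpi_add addrA.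
Qed.

Lemma quot_addC : commutative quot_add.
Proof. by elim/qpi_ind=> u; elim/qpi_ind=> v; rewrite !qpi_add addrC. Qed.

Lemma quot_add0 : left_id quot_zero quot_add.
Proof. by elim/qpi_ind=> u; rewrite qpi_add add0r. Qed.

Lemma quot_addN : left_inverse quot_zero quot_opp quot_add.
Proof. by elim/qpi_ind=> u; rewrite qpi_opp qpi_add addNr. Qed.

HB.instance Definition _ :=
  GRing.isZmodule.Build quot quot_addA quot_addC quot_add0 quot_addN.

Lemma quot_scaleA a b x : quot_scale a (quot_scale b x) = quot_scale (a * b) x.
Proof. by elim/qpi_ind: x => u; rewrite !qpi_scale scalerA. Qed.

Lemma quot_scale1 : left_id 1 quot_scale.
Proof. by elim/qpi_ind=> u; rewrite qpi_scale scale1r. Qed.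

Lemma quot_scaleDr : right_distributive quot_scale +%R.
Proof.
move=> a; elim/qpi_ind=> u; elim/qpi_ind=> v.
by rewrite -[qpi u + _]/(quot_add _ _) -[RHS]/(quot_add _ _) qpi_add !qpi_scale
  qpi_add scalerDr.
Qed.

Lemma quot_scaleDl x : {morph quot_scale^~ x : a b / a + b}.
Proof.
elim/qpi_ind: x => u a b.
by rewrite -[RHS]/(quot_add _ _) !qpi_scale qpi_add scalerDl.
Qed.

HB.instance Definition _ := GRing.Zmodule_isLmodule.Build R quot
  quot_scaleA quot_scale1 quot_scaleDr quot_scaleDl.

End Quotient.

Unset Implicit Arguments.

(** A simplex is represented by its vertex set, the closed simplex itself being
    [body C]; an m-dimensional simplex has m+1 vertices. *)

Notation pt R n := 'rV[R]_n.
Notation simplex R n := {fset pt R n}.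

Section Simplices.
Context {R : realType} {n : nat}.
Implicit Types (C F G E : simplex R n) (T U M N : {fset simplex R n}).

Definition body C : set (pt R n) :=
  [set x | exists w : pt R n -> R,
     [/\ forall v, v \in C -> 0 <= w v, \sum_(v <- C) w v = 1 &
         x = \sum_(v <- C) w v *: v]].

(** Vectors parallel to the affine hull of [C]. *)
Definition tangent C : set (pt R n) :=
  [set t | exists w : pt R n -> R,
     \sum_(v <- C) w v = 0 /\ t = \sum_(v <- C) w v *: v].

Definition affine_indep C :=
  forall w : pt R n -> R,
    \sum_(v <- C) w v = 0 -> \sum_(v <- C) w v *: v = 0 ->
    forall v, v \in C -> w v = 0.

Definition is_simplex C := C != fset0 /\ affine_indep C.

Definition face F C : bool := (F != fset0) && (F `<=` C)%fset.
Definition proper_face F C : bool := face F C && (F != C).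

Definition simplicial_complex T :=
  [/\ forall C, C \in T -> is_simplex C,
      forall C F, C \in T -> face F C -> F \in T &
      forall C D, C \in T -> D \in T -> body C `&` body D !=set0 ->
        exists E, [/\ face E C, face E D & body E = body C `&` body D]].

Definition subcomplex U T := (U `<=` T)%fset /\ simplicial_complex U.

(** The members with [p] vertices, so that T^m is [cells T m.+1] and
    T^{m-1} is [cells T m], which is empty if m = 0. *)
Definition cells T (p : nat) : {fset simplex R n} :=
  [fset C in T | #|` C|%fset == p]%fset.

Definition pure_dim (m : nat) T :=
  forall C, C \in T -> exists2 D, D \in cells T m.+1 & face C D.

(** The (p-1)-skeleton: the members that are subsimplices of some
    (p-1)-dimensional member. *)
Definition skeleton M (p : nat) : {fset simplex R n} :=
  [fset G in M | [exists E : cells M p, face G (val E)]]%fset.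

(** An orientation of [C] is a sign attached to each ordering of its vertices
    which changes whenever two neighbours are exchanged ([true] means positively
    oriented).  For a vertex both signs are possible. *)
Definition orientation C (w : seq (pt R n) -> bool) :=
  forall s t x y, perm_eq (s ++ x :: y :: t) C ->
    w (s ++ y :: x :: t) = ~~ w (s ++ x :: y :: t).

Definition euclidean C (w : seq (pt R n) -> bool) :=
  forall v s, perm_eq (v :: s) C ->
    w (v :: s) = (0 < \det (\matrix_(i < n) (nth 0 s i - v))).

Definition oriented T (ori : simplex R n -> seq (pt R n) -> bool) :=
  (forall C, C \in T -> orientation C (ori C)) /\
  (forall C, C \in cells T n.+1 -> euclidean C (ori C)).

Variable ori : simplex R n -> seq (pt R n) -> bool.

(** If [v] is the vertex of [C] opposite to the facet [F], the orientation
    induced on [F] (outward normal first) makes an ordering [s] of [F] positive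
    iff [v :: s] is positive in [C]. *)
Definition osign F C : R :=
  if ori C (enum_fset (C `\` F)%fset ++ enum_fset F) == ori F (enum_fset F)
  then 1 else -1.

(** [chain M m.+1] is C_m(M), and [chain M 0] is C_{-1}(M) = 0. *)
Definition chain M (p : nat) : lmodType R := {ffun cells M p -> R^o}.

Definition boundary {M p} (c : chain M p.+1) : chain M p :=
  [ffun F : cells M p =>
     \sum_(C : cells M p.+1 | proper_face (val F) (val C))
       osign (val F) (val C) * c C].

Definition subchain M N p : set (chain M p) :=
  [set c | forall C : cells M p, val C \notin N -> c C = 0].

Definition rel_chain M N p : lmodType R := quot (subchain M N p).

Definition rel_boundary M N p (x : rel_chain M N p.+1) : rel_chain M N p :=
  qpi _ (boundary (repr x)).

(** The m-th homology space ker/im, as a subspace of the quotient of the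
    m-chains by the boundaries. *)
Definition homology M N (m : nat) :
    set (quot (range (rel_boundary M N m.+1))) :=
  qpi _ @` [set z | rel_boundary M N m z = 0].

(** The patch M_F and its subcomplex N_F. *)
Definition patchM T F : {fset simplex R n} :=
  [fset G in T | [exists C : cells T n.+1, face F (val C) && face G (val C)]]%fset.

Definition patchN T U F : {fset simplex R n} :=
  [fset G in skeleton (patchM T F) n | ~~ face F G || (G \in U)]%fset.

Definition local_patch T U :=
  forall F, F \in T -> forall m, (m < n)%N ->
    homology (patchM T F) (patchN T U F) m = [set 0].

End Simplices.

Section Forms.
Context {R : realType} {n : nat}.

Fixpoint continuously_differentiable {V W : normedModType R} (r : nat)
    (f : V -> W) : Prop :=
  match r with
  | 0 => continuous f
  | r'.+1 => (forall x, differentiable f x) /\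
             (forall v, continuously_differentiable r' (fun x => 'D_v f x))
  end.

Definition smooth {V W : normedModType R} (f : V -> W) :=
  forall r, continuously_differentiable r f.

(** [w x V] is the value at the point [x] on the [k] rows of [V].  A form on a
    simplex [C] is extended by 0 to points outside of [C] and to tuples that are
    not tangent to [C], so that equal forms on [C] are equal functions. *)
Definition kform (k : nat) : lmodType R := pt R n -> 'M[R]_(k, n) -> R^o.

Definition alternating {k} (f : 'M[R]_(k, n) -> R) :=
  (forall A B C i b c,
      row i A = b *: row i B + c *: row i C ->
      row' i B = row' i A -> row' i C = row' i A ->
      f A = b * f B + c * f C) /\
  (forall A i j, i != j -> row i A = row j A -> f A = 0).

Definition smooth_form k (w : kform k) :=
  (forall x, alternating (w x)) /\ (forall V, smooth (fun x => w x V : R^o)).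

(** Pullback to [F], of a form on R^n or on a simplex containing [F]. *)
Definition trace (F : simplex R n) {k} (w : kform k) : kform k := fun x V =>
  if `[< body F x /\ forall i, tangent F (row i V) >] then w x V else 0.

(** The smooth forms on [C], smooth up to the boundary: the pullbacks to [C] of
    smooth forms on R^n. *)
Definition smooth_forms (C : simplex R n) k : set (kform k) :=
  trace C @` smooth_form k.

Definition dform {k} (w : kform k) : kform k.+1 := fun x V =>
  \sum_(i < k.+1) (-1) ^+ i * 'D_(row i V) (fun y => w y (row' i V) : R^o) x.

(** The exterior derivative on [C], computed from any smooth extension. *)
Definition dC (C : simplex R n) {k} (w : kform k) : kform k.+1 :=
  trace C (dform (xget 0 [set e | smooth_form k e /\ trace C e = w])).

Definition one_on (C : simplex R n) : kform 0 := trace C (fun _ _ => 1).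

End Forms.

Arguments kform : clear implicits.

Section FEEC.
Context {R : realType} {n : nat}.
Variables (T U : {fset simplex R n}).
Variable (ori : simplex R n -> seq (pt R n) -> bool).
Variable (Lambda : forall k, simplex R n -> set (kform R n k)).

Definition form_spaces :=
  [/\ forall k C, C \in T ->
        Lambda k C `<=` smooth_forms C k /\ findim_subspace (Lambda k C),
      forall k C, C \in T -> (#|` C|%fset <= k)%N -> Lambda k C = [set 0],
      forall k C w, C \in T -> Lambda k C w -> Lambda k.+1 C (dC C w) &
      forall k C F, C \in T -> face F C ->
        trace F @` Lambda k C = Lambda k F].

(** Exactness at Lambda^1, ..., Lambda^m, the last map being 0 because
    Lambda^{m+1}(C) = 0; exactness at ker d^0 and Lambda^0 holds by
    definition. *)
Definition local_exactness :=
  forall C m, C \in cells (T `\` U)%fset m.+1 ->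
    (forall k, (k < m)%N ->
       dC C @` Lambda k C = [set w | Lambda k.+1 C w /\ dC C w = 0]) /\
    [set w | Lambda 0 C w /\ dC C w = 0] = lspan [set one_on C].

Definition Lambda_bubble k (F : simplex R n) : set (kform R n k) :=
  [set w | Lambda k F w /\ forall G, proper_face G F -> trace G w = 0].

Definition geometric_decomposition :=
  forall k, exists ext : simplex R n -> simplex R n -> kform R n k -> kform R n k,
  [/\ forall F C, C \in T -> face F C ->
        (forall w, Lambda_bubble k F w -> Lambda k C (ext F C w)) /\
        (forall a u v, Lambda_bubble k F u -> Lambda_bubble k F v ->
           ext F C (a *: u + v) = a *: ext F C u + ext F C v),
      forall F C w, C \in T -> face F C -> Lambda_bubble k F w ->
        trace F (ext F C w) = w,
      forall F G C w, C \in T -> face F G -> face G C -> Lambda_bubble k F w ->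
        ext F G w = trace G (ext F C w) &
      forall F G C w, C \in T -> face F C -> face G C -> ~~ face F G ->
        Lambda_bubble k F w -> trace G (ext F C w) = 0].

(** Families of k-forms indexed by simplices; the direct sum over
    T^m \ U^m consists of the families vanishing elsewhere. *)
Definition kforms k : lmodType R := simplex R n -> kform R n k.

Definition Lambda_1 m k : set (kforms k) :=
  [set w | forall C, if C \in cells (T `\` U)%fset m.+1
                     then Lambda k C (w C) else w C = 0].

Definition Dop m {k} (w : kforms k) : kforms k.+1 := fun C =>
  if C \in cells (T `\` U)%fset m.+1 then dC C (w C) else 0.

Definition Top m {k} (w : kforms k) : kforms k := fun F =>
  if F \in cells (T `\` U)%fset m
  then \sum_(C <- cells (T `\` U)%fset m.+1 | proper_face F C)
         osign ori F C *: trace F (w C)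
  else 0.

Definition LambdaT m k : set (kforms k) :=
  [set w | Lambda_1 m k w /\ Top m w = 0].

Definition GammaT m k : set (kforms k) :=
  [set w | Lambda_1 m k w /\ Dop m w = 0].

(** The image of D^m_{k-1} on Lambda^{k-1}(T^m), which is 0 for k = 0. *)
Definition exact_forms m k : set (kforms k) :=
  match k with
  | 0 => [set 0]
  | j.+1 => Dop m @` LambdaT m j
  end.

Variable ip : forall m k : nat, kforms k -> kforms k -> R.

Definition harmonic_forms k : set (kforms k) :=
  [set w | [/\ LambdaT n k w, Dop n w = 0 &
               forall u, exact_forms n k u -> ip n k w u = 0]].

Definition harmonic_chains m : set (kforms 0) :=
  [set w | [/\ GammaT m 0 w, Top m w = 0 &
               forall u, (Top m.+1 @` GammaT m.+1 0) u -> ip m 0 w u = 0]].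

End FEEC.

Arguments kforms : clear implicits.

(* Main.v *)
Require Import Defs.
From mathcomp Require Import all_boot all_order all_algebra.
From mathcomp Require Import finmap.
From mathcomp Require Import all_classical all_reals all_analysis.
Import Order.TTheory GRing.Theory Num.Theory.
Import numFieldNormedType.Exports.

Set Implicit Arguments.
Unset Strict Implicit.
Unset Printing Implicit Defensive.

Local Open Scope classical_set_scope.
Local Open Scope ring_scope.

(** The spaces of families of forms on cells make up a double complex: the
    exterior derivative D raises the degree k of the forms, and the signed sum
    of traces T lowers the dimension m of the cells.  Two exactness properties
    determine its homology.

    - For fixed m, the columns are exact except at k = 0, where the kernel of D
      consists of the families of constants, i.e. of the relative simplicial
      m-chains, T being their boundary operator ([Top_chain_form]).  This is
      local exactness ([Dop_exact]).
    - For fixed k, the rows are exact except at m = n, where the kernel of T is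
      Lambda^k(T^n) ([Top_exact]).

    Exactness of the rows is the heart of the matter.  Given a family w with
    T w = 0, look at its traces on the smallest faces F on which they do not all
    vanish.  They have vanishing traces on the boundary of F, so they lie in the
    space of bubbles of F, and since T w = 0 they form a relative cycle on the
    patch of F with coefficients in that space.  By the patch condition the
    cycle bounds ([patch_vector_exact]); extending the coefficients of a
    bounding chain into the cells gives a family a such that w - T a has no
    trace left on faces of this size, while the traces on smaller faces remain
    zero ([remove_traces]).  Repeating this up to the full dimension exhausts w.

    With both properties, the usual zigzag D a = w, T a = w' moves classes along
    an antidiagonal ([antidiagonal_step]), from the cohomology of D in degree k
    on the kernel of T at m = n to the homology of T in dimension n - k on the
    kernel of D at k = 0.  The harmonic spaces represent these two homologies,
    being the orthogonal complements of the boundaries in finite-dimensional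
    spaces of cycles ([harmonic_subquotient_iso]).

    That there is a double complex at all rests on two facts: the exterior
    derivative on a simplex is independent of the smooth extension used to
    compute it, hence linear and compatible with traces ([dCE]), and the two
    facets between a cell and a face of codimension two contribute with opposite
    signs ([osign_sum_eq0]). *)

(** * Subspaces and subquotients *)

Definition subspace (R : nzRingType) (V : lmodType R) (A : set V) :=
  A 0 /\ forall a u v, A u -> A v -> A (a *: u + v).

Definition linear_on (R : nzRingType) (V W : lmodType R) (A : set V)
    (f : V -> W) :=
  forall a u v, A u -> A v -> f (a *: u + v) = a *: f u + f v.

Section Subspaces.
Variables (R : nzRingType) (V W : lmodType R).
Implicit Types (A : set V) (u v : V).

Lemma subspaceZ A a u : subspace A -> A u -> A (a *: u).
Proof. by move=> [A0 Al] Au; rewrite -[_ *: _]addr0; apply: Al. Qed.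

Lemma subspaceD A u v : subspace A -> A u -> A v -> A (u + v).
Proof. by move=> [A0 Al] Au Av; rewrite -[u]scale1r; apply: Al. Qed.

Lemma subspaceB A u v : subspace A -> A u -> A v -> A (u - v).
Proof. by move=> [A0 Al] Au Av; rewrite addrC -scaleN1r; apply: Al. Qed.

Lemma subspace_sum A (I : Type) (r : seq I) (P : pred I) (F : I -> V) :
  subspace A -> (forall i, P i -> A (F i)) -> A (\sum_(i <- r | P i) F i).
Proof.
move=> sA AF; apply: (big_ind A) => //; first exact: sA.1.
by move=> u v; apply: subspaceD.
Qed.

Lemma linear_on0 A (f : V -> W) : subspace A -> linear_on A f -> f 0 = 0.
Proof.
move=> [A0 _] fl; have := fl (-1) 0 0 A0 A0.
by rewrite !scaleN1r !addNr.
Qed.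

Lemma linear_onB A (f : V -> W) u v :
  subspace A -> linear_on A f -> A u -> A v -> f (u - v) = f u - f v.
Proof.
by move=> sA fl Au Av; rewrite addrC -scaleN1r fl// scaleN1r addrC.
Qed.

Lemma linear_on_sum A (f : V -> W) (I : Type) (r : seq I) (P : pred I)
    (a : I -> R) (F : I -> V) :
  subspace A -> linear_on A f -> (forall i, P i -> A (F i)) ->
  f (\sum_(i <- r | P i) a i *: F i) = \sum_(i <- r | P i) a i *: f (F i).
Proof.
move=> sA fl AF; elim: r => [|i r IH].
  by rewrite !big_nil; apply: linear_on0 sA fl.
rewrite !big_cons; case: ifP => // Pi; rewrite fl ?IH//; first exact: AF.
by apply: subspace_sum => // j Pj; apply/(subspaceZ _ sA)/AF.
Qed.

Lemma subspace_image A (f : V -> W) :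
  subspace A -> linear_on A f -> subspace (f @` A).
Proof.
move=> sA fl; split; first by exists 0; [exact: sA.1|apply: linear_on0 sA fl].
move=> a _ _ [u Au <-] [v Av <-]; exists (a *: u + v); first exact: sA.2.
by rewrite fl.
Qed.

Lemma subspace_kernel A (f : V -> W) :
  subspace A -> linear_on A f -> subspace [set u | A u /\ f u = 0].
Proof.
move=> sA fl; split; first by split; [exact: sA.1|apply: linear_on0 sA fl].
move=> a u v [Au fu] [Av fv]; split; first exact: sA.2.
by rewrite fl// fu fv scaler0 addr0.
Qed.

End Subspaces.

Lemma linear_onS (R : nzRingType) (V W : lmodType R) (A B : set V)
  (f : V -> W) : A `<=` B -> linear_on B f -> linear_on A f.
Proof. by move=> AB fl a u v /AB Bu /AB Bv; apply: fl. Qed.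

(** An isomorphism Z/B -> Z'/B' given by the linear relation of all pairs of
    representatives; quotient spaces need not be formed, and a diagram chase
    reads off the relation directly. *)
Definition subquotient_iso (R : nzRingType) (V W : lmodType R)
    (Z B : set V) (Z' B' : set W) :=
  exists L : V -> W -> Prop,
  [/\ forall a u v u' v', L u u' -> L v v' -> L (a *: u + v) (a *: u' + v'),
      forall u, Z u -> exists u', L u u',
      forall u', Z' u' -> exists u, L u u' &
      forall u u', L u u' -> [/\ Z u, Z' u' & B u <-> B' u']].

Section SubquotientIso.
Variable R : nzRingType.

Lemma subquotient_iso_refl (V : lmodType R) (Z B : set V) :
  subspace Z -> subquotient_iso Z B Z B.
Proof.
move=> sZ; exists (fun u v => u = v /\ Z u); split.
- move=> a u v _ _ [<- Zu] [<- Zv]; split=> //; exact: sZ.2.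
- by move=> u; exists u.
- by move=> u; exists u.
- by move=> u _ [<- Zu].
Qed.

Lemma subquotient_iso_sym (V W : lmodType R) (Z B : set V) (Z' B' : set W) :
  subquotient_iso Z B Z' B' -> subquotient_iso Z' B' Z B.
Proof.
move=> [L [Ll Lt Ls LZ]]; exists (fun v u => L u v); split=> //.
- by move=> a u v u' v'; apply: Ll.
- by move=> v u /LZ[? ? ?]; split=> //; apply: iff_sym.
Qed.

Lemma subquotient_iso_trans (V1 V2 V3 : lmodType R) (Z1 B1 : set V1)
    (Z2 B2 : set V2) (Z3 B3 : set V3) :
  subquotient_iso Z1 B1 Z2 B2 -> subquotient_iso Z2 B2 Z3 B3 ->
  subquotient_iso Z1 B1 Z3 B3.
Proof.
move=> [L [Ll Lt Ls LZ]] [L' [Ll' Lt' Ls' LZ']].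
exists (fun u w => exists v, L u v /\ L' v w); split.
- move=> a u v u' v' [x [ux xu']] [y [vy yv']].
  by exists (a *: x + y); split; [apply: Ll|apply: Ll'].
- move=> u /Lt[v uv]; have [_ /Lt'[w vw] _] := LZ _ _ uv.
  by exists w, v.
- move=> w /Ls'[v vw]; have [/Ls[u uv] _ _] := LZ' _ _ vw.
  by exists u, v.
- move=> u w [v [/LZ[Zu _ Bu] /LZ'[_ Zw Bv]]]; split=> //.
  exact: iff_trans Bu Bv.
Qed.

(** When nothing is divided out, the relation is the graph of a function. *)
Lemma subquotient_lin_iso (V W : lmodType R) (Z : set V) (Z' : set W) :
  subquotient_iso Z [set 0] Z' [set 0] -> lin_iso Z Z'.
Proof.
move=> [L [Ll Lt Ls LZ]].
have Lfun u v v' : L u v -> L u v' -> v = v'.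
  move=> uv /(Ll (-1) _ _ _ _ uv) /LZ[_ _ [+ _]].
  by rewrite !scaleN1r addNr => /(_ erefl)/eqP; rewrite addrC subr_eq0 eq_sym => /eqP.
have Linj u u' v : L u v -> L u' v -> u = u'.
  move=> uv /(Ll (-1) _ _ _ _ uv) /LZ[_ _ [_]].
  by rewrite !scaleN1r addNr => /(_ erefl)/eqP; rewrite addrC subr_eq0 eq_sym => /eqP.
pose f u := xget 0 [set v | L u v].
have fL u : Z u -> L u (f u) by move=> /Lt; apply: (@xgetPex _ 0 [set v | L u v]).
exists f; split.
  move=> a u v Zu Zv; have Luv := Ll a _ _ _ _ (fL _ Zu) (fL _ Zv).
  by have [Zuv _ _] := LZ _ _ Luv; apply: Lfun (fL _ Zuv) Luv.
split.
- by move=> u /fL/LZ[].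
- move=> u v /set_mem Zu /set_mem Zv fuv.
  by apply: (Linj _ _ (f u)); [exact: fL|rewrite fuv; apply: fL].
- move=> v /Ls[u uv]; have [Zu _ _] := LZ _ _ uv.
  by exists u => //; apply: Lfun (fL _ Zu) uv.
Qed.

End SubquotientIso.

(** * Harmonic representatives *)

(** Spans are described recursively because both arguments below, on subspaces
    and on projections, go by induction on the spanning sequence. *)
Fixpoint seq_span (R : nzRingType) (V : lmodType R) (e : seq V) : set V :=
  if e is x :: e' then [set v | exists a, seq_span e' (v - a *: x)]
  else [set 0].

Section Span.
Variables (R : realType) (V : lmodType R).
Implicit Types (e : seq V) (A B Z : set V).

Lemma subspace_seq_span e : subspace (seq_span e).
Proof.
elim: e => [|x e [IH0 IHl]].
  by split=> // a u v -> ->; rewrite /= scaler0 addr0.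
split; first by exists 0; rewrite scale0r subr0.
move=> a u v [b ub] [c vc]; exists (a * b + c).
by rewrite scalerDl -scalerA opprD addrACA -scalerBr; apply: IHl.
Qed.

Lemma seq_span_cat e1 e2 u v :
  seq_span e1 u -> seq_span e2 v -> seq_span (e1 ++ e2) (u + v).
Proof.
elim: e1 u => [u -> |x e1 IH u [a ua]] ev; first by rewrite add0r.
by exists a; rewrite addrAC; apply: IH.
Qed.

Lemma seq_span_mem e x : x \in e -> seq_span e x.
Proof.
elim: e => // y e IH; rewrite inE => /orP[/eqP->|/IH xe].
  by exists 1; rewrite scale1r subrr; apply: (subspace_seq_span e).1.
by exists 0; rewrite scale0r subr0.
Qed.

Lemma lspan_seq_span e : lspan [set` e] `<=` seq_span e.
Proof.
move=> _ [m [c [s [es ->]]]]; apply: subspace_sum.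
  exact: subspace_seq_span.
move=> i _; apply: subspaceZ; first exact: subspace_seq_span.
by apply: seq_span_mem; exact: es.
Qed.

(** By induction on the spanning sequence of the ambient space: at most one
    vector of [B] has to be added for each of its members. *)
Lemma subspace_has_span e B :
  subspace B -> B `<=` seq_span e ->
  exists2 s, B `<=` seq_span s & {in s, forall x, B x}.
Proof.
elim: e B => [B sB Be|x e IH B sB Be]; first by exists [::].
have [||s Bs sB'] := IH (B `&` seq_span e).
- split; first by split; [exact: sB.1|exact: (subspace_seq_span e).1].
  by move=> a u v [? ?] [? ?]; split; [apply: sB.2|apply: (subspace_seq_span e).2].
- by move=> v [].
have {}sB' : {in s, forall x, B x} by move=> y /sB'[].
have [Bin|/existsNP[b /not_implyP[Bb eb]]] := pselect (B `<=` seq_span e).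
  by exists s => // v Bv; apply: Bs; split=> //; apply: Bin.
have [a ba] := Be _ Bb.
have a0 : a != 0 by apply: contra_notN eb => /eqP a0; move: ba; rewrite a0 scale0r subr0.
exists (b :: s); last by move=> y; rewrite inE => /orP[/eqP->|/sB'].
move=> v Bv; have [c vc] := Be _ Bv; exists (c / a); apply: Bs; split.
  by apply: subspaceB => //; apply: subspaceZ.
have := subspaceB (subspace_seq_span e) vc (subspaceZ (c / a) (subspace_seq_span e) ba).
by rewrite scalerBr scalerA divfK// opprB addrA subrK.
Qed.

(** Gram--Schmidt: once [z] and [x] are projected to the span of [s], only the
    component of [z - p] along [x - q] remains to be removed. *)
Lemma seq_span_projection A (ip : V -> V -> R) (s : seq V) z :
  subspace A -> scalar_product A ip -> {in s, forall x, A x} -> A z ->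
  exists2 p, seq_span s p & forall u, seq_span s u -> ip (z - p) u = 0.
Proof.
move=> sA [ipl ipC ip_gt0].
have ip0 u : A u -> ip 0 u = 0.
  move=> Au; have := ipl (-1) u u u Au Au Au.
  by rewrite scaleN1r addNr mulN1r addNr.
have A0 : A 0 by exact: sA.1.
have spanA e : {in e, forall x, A x} -> seq_span e `<=` A.
  elim: e => [_ _ ->|x e IH eA v [a /IH va]]; first exact: sA.1.
  rewrite -(subrK (a *: x) v); apply: subspaceD => //.
    by apply: va => y ye; apply: eA; rewrite inE ye orbT.
  by apply: subspaceZ => //; apply: eA; rewrite inE eqxx.
elim: s z => [z _ Az|x s IH z sAx Az].
  by exists 0 => // u ->; rewrite subr0 (ipC _ _ Az A0) ip0.
have As : {in s, forall x, A x} by move=> y ys; apply: sAx; rewrite inE ys orbT.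
have Ax : A x by apply: sAx; rewrite inE eqxx.
have [q sq oq] := IH _ As Ax; have [p sp op] := IH _ As Az.
have [Aq Ap] := (spanA _ As _ sq, spanA _ As _ sp).
have [Axq Azp] : A (x - q) /\ A (z - p) by split; apply: subspaceB.
have spanI u : seq_span s u -> seq_span (x :: s) u.
  by exists 0; rewrite scale0r subr0.
pose c := ip (z - p) (x - q) / ip (x - q) (x - q).
(* If x already lies in the span of s, then x - q = 0 and both sides vanish. *)
have cE : ip (z - p) (x - q) = c * ip (x - q) (x - q).
  rewrite /c; have [->|xq0] := eqVneq (x - q) 0.
    by rewrite (ipC _ _ Azp A0) (ip0 _ Azp) (ip0 _ A0) mulr0.
  by rewrite divfK// gt_eqF// ip_gt0.
exists (p + c *: (x - q)).
  apply: subspaceD; [exact: subspace_seq_span|exact: spanI|].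
  apply: subspaceZ; first exact: subspace_seq_span.
  by exists 1; rewrite scale1r addrAC subrr add0r -scaleN1r;
    apply: (subspaceZ _ (subspace_seq_span s) sq).
move=> u [a ua].
have Au : A u.
  by rewrite -(subrK (a *: x) u); exact: subspaceD sA (spanA _ As _ ua) (subspaceZ a sA Ax).
have Au' : A (u - a *: (x - q)).
  by apply: subspaceB => //; apply: subspaceZ.
have su' : seq_span s (u - a *: (x - q)).
  rewrite scalerBr opprB addrCA addrC; apply: subspaceD => //.
    exact: subspace_seq_span.
  by apply: subspaceZ => //; apply: subspace_seq_span.
have -> : z - (p + c *: (x - q)) = (- c) *: (x - q) + (z - p).
  by rewrite opprD addrA scaleNr addrC.
rewrite ipl// -{2}(subrK (a *: (x - q)) u) -{1}(subrK (a *: (x - q)) u).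
have ipr y : A y -> ip y (u - a *: (x - q) + a *: (x - q)) =
    ip y (u - a *: (x - q)) + a * ip y (x - q).
  move=> Ay; rewrite ipC//; last by rewrite subrK.
  by rewrite addrC ipl// addrC [ip _ y]ipC// [ip (x - q) y]ipC.
by rewrite !ipr// oq// op// !add0r cE mulNr mulrCA addNr.
Qed.

(** Each class of cycles modulo boundaries has exactly one representative that
    is orthogonal to the boundaries. *)
Lemma harmonic_subquotient_iso A (ip : V -> V -> R) (e : seq V) Z B :
  subspace A -> scalar_product A ip -> A `<=` seq_span e ->
  subspace Z -> subspace B -> Z `<=` A -> B `<=` Z ->
  subquotient_iso Z B [set z | Z z /\ forall u, B u -> ip z u = 0] [set 0].
Proof.
move=> sA ipA Ae sZ sB ZA BZ; have [ipl ipC ip_gt0] := ipA.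
have [s Bs sB'] := subspace_has_span sB (fun u Bu => Ae _ (ZA _ (BZ _ Bu))).
have As : {in s, forall x, A x} by move=> x /sB' Bx; apply/ZA/BZ.
have spanB : seq_span s `<=` B.
  elim: s sB' {Bs As} => [_ _ -> |x s IH sB' v [a /IH va]]; first exact: sB.1.
  rewrite -(subrK (a *: x) v); apply: subspaceD => //.
    by apply: va => y ye; apply: sB'; rewrite inE ye orbT.
  by apply: subspaceZ => //; apply: sB'; rewrite inE eqxx.
exists (fun z h => [/\ Z z, Z h, forall u, B u -> ip h u = 0 & B (z - h)]); split.
- move=> a u v u' v' [Zu Zu' ou Bu] [Zv Zv' ov Bv]; split.
  + exact: sZ.2.
  + exact: sZ.2.
  + move=> w Bw; rewrite ipl ?ou ?ov ?mulr0 ?addr0//; do ?exact: ZA.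
    exact/ZA/BZ.
  + by rewrite opprD addrACA -scalerBr; apply: sB.2.
- move=> z Zz; have [p sp op] := seq_span_projection sA ipA As (ZA _ Zz).
  have Bp := spanB _ sp.
  exists (z - p); split=> //; first by apply: subspaceB => //; apply: BZ.
    by move=> u /Bs; apply: op.
  by rewrite opprB addrCA subrr addr0.
- move=> h [Zh oh]; exists h; split=> //; rewrite subrr; exact: sB.1.
- move=> z h [Zz Zh oh Bzh]; split=> //; split=> [Bz|/= h0]; last first.
    by rewrite -[z]subr0 -h0.
  have Bh : B h by rewrite -(subKr z h); apply: subspaceB.
  apply/eqP; apply: contraT => h0; have := ip_gt0 _ (ZA _ Zh) h0.
  by rewrite oh// ltxx.
Qed.

End Span.

(** * The double complex *)

(** A first quadrant double complex, given by subspaces [X m k] of spaces [V k],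
    with [D] raising [k] and [T] lowering [m]; [total_boundaries] collects what
    a diagram chase can produce from either side. *)
Section DoubleComplex.
Variables (R : nzRingType) (V : nat -> lmodType R).
Variable X : nat -> forall k, set (V k).
Variable D : nat -> forall k, V k -> V k.+1.
Variable T : nat -> forall k, V k -> V k.

Definition double_cycles m k : set (V k) :=
  [set w | [/\ X m w, T m w = 0 & D m w = 0]].

Definition D_boundaries m k : set (V k) :=
  match k with
  | 0 => [set 0]
  | j.+1 => D m (k:=j) @` [set w | X m w /\ T m w = 0]
  end.

Definition T_boundaries m k : set (V k) :=
  T m.+1 (k:=k) @` [set w | X m.+1 w /\ D m.+1 w = 0].

Definition total_boundaries m k : set (V k) :=
  [set w | exists u v, [/\ D_boundaries m u, T_boundaries m v & w = u + v]].

Variable n : nat.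
Hypothesis X_sub : forall m k, subspace (@X m k).
Hypothesis D_lin : forall m k, linear_on (@X m k) (@D m k).
Hypothesis T_lin : forall m k, linear_on (@X m k) (@T m k).
Hypothesis D_X : forall m k w, @X m k w -> X m (D m w).
Hypothesis T_X : forall m k w, @X m.+1 k w -> X m (T m.+1 w).
Hypothesis DD : forall m k w, @X m k w -> D m (D m w) = 0.
Hypothesis TT : forall m k w, @X m.+1 k w -> T m (T m.+1 w) = 0.
Hypothesis DT : forall m k w, @X m.+1 k w -> D m (T m.+1 w) = T m.+1 (D m.+1 w).
Hypothesis D_exact : forall m k w, @X m k.+1 w -> D m w = 0 ->
  exists2 a, X m a & D m a = w.
Hypothesis T_exact : forall m k w, (m < n)%N -> @X m k w -> T m w = 0 ->
  exists2 a, X m.+1 a & T m.+1 a = w.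

Lemma subspace_double_cycles m k : subspace (@double_cycles m k).
Proof.
split; first by split; [exact: (X_sub m k).1| |];
  [apply: linear_on0 (X_sub m k) (@T_lin _ _)|
   apply: linear_on0 (X_sub m k) (@D_lin _ _)].
move=> a u v [Xu Tu Du] [Xv Tv Dv]; split.
- exact: (X_sub m k).2.
- by rewrite T_lin// Tu Tv scaler0 addr0.
- by rewrite D_lin// Du Dv scaler0 addr0.
Qed.

Lemma subspace_D_boundaries m k : subspace (@D_boundaries m k).
Proof.
case: k => [|k] /=.
  by split=> // a u v -> ->; rewrite scaler0 addr0.
apply: subspace_image; first exact/subspace_kernel/T_lin.
by apply: linear_onS (@D_lin m k) => w [].
Qed.

Lemma subspace_T_boundaries m k : subspace (@T_boundaries m k).
Proof.
apply: subspace_image; first exact/subspace_kernel/D_lin.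
by apply: linear_onS (@T_lin m.+1 k) => w [].
Qed.

(** One step along the antidiagonal: the two classes are the two images D a and
    T a of a common element [a].  It exists on one side because columns are
    exact, on the other because rows are. *)
Lemma antidiagonal_step m k : (m < n)%N ->
  subquotient_iso (@double_cycles m.+1 k.+1) (@total_boundaries m.+1 k.+1)
                  (@double_cycles m k) (@total_boundaries m k).
Proof.
move=> mn.
exists (fun w w' => exists a, [/\ X m.+1 a, D m.+1 a = w, T m.+1 a = w',
  T m.+1 w = 0 & D m w' = 0]); split.
- move=> a u v u' v' [x [Xx Dx Tx Tu Du']] [y [Xy Dy Ty Tv Dv']].
  exists (a *: x + y); split.
  + exact: (X_sub _ _).2.
  + by rewrite D_lin// Dx Dy.
  + by rewrite T_lin// Tx Ty.
  + rewrite T_lin ?Tu ?Tv ?scaler0 ?addr0// -?Dx -?Dy; exact: D_X.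
  + rewrite D_lin ?Du' ?Dv' ?scaler0 ?addr0// -?Tx -?Ty; exact: T_X.
- move=> w [Xw Tw Dw]; have [a Xa Da] := D_exact Xw Dw.
  exists (T m.+1 a), a; split=> //.
  by rewrite DT// Da.
- move=> w' [Xw' Tw' Dw']; have [a Xa Ta] := T_exact mn Xw' Tw'.
  exists (D m.+1 a), a; split=> //.
  by rewrite -DT// Ta.
move=> w w' [a [Xa Da Ta Tw Dw']]; split.
- by split=> //; [rewrite -Da; apply: D_X|rewrite -Da DD].
- by split=> //; [rewrite -Ta; apply: T_X|rewrite -Ta TT].
have X2 := X_sub m.+1 k.
split=> [[_ [_ [[b [Xb Tb] <-] [c [Xc Dc] <-] wE]]]|
         [u [_ [Du [c [Xc Dc] <-] w'E]]]].
- (* w = D b + T c with T b = 0, D c = 0.  Writing c = D e makes a - b - T e a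
     D-cycle, and it still has T-image w'. *)
  have [e Xe De] := D_exact Xc Dc.
  pose d := a - b - T m.+2 e.
  have Xab : X m.+1 (a - b) by apply: subspaceB.
  have XTe : X m.+1 (T m.+2 e) by apply: T_X.
  have Dd : D m.+1 d = 0.
    rewrite /d (linear_onB X2 (@D_lin _ _))// (linear_onB X2 (@D_lin _ _))//.
    by rewrite Da DT// De wE addrAC addrK subrr.
  exists 0, (T m.+1 d); split.
  + exact: (subspace_D_boundaries m k).1.
  + by exists d => //; split=> //; apply: subspaceB.
  + rewrite /d (linear_onB X2 (@T_lin _ _))// (linear_onB X2 (@T_lin _ _))//.
    by rewrite Tb TT// !subr0 add0r.
- (* w' = u + T c with D c = 0 and u a boundary of D, so u = T e' for a D-cycle
     e'; then a - e' - c is a T-cycle with D-image w. *)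
  have [e' [Xe Te De]] : exists e', [/\ X m.+1 e', T m.+1 e' = u & D m.+1 e' = 0].
    case: k u a w w' c Xa Da Ta Tw Dw' Xc Dc w'E X2 Du
      => /= [|k] u a w w' c Xa Da Ta Tw Dw' Xc Dc w'E X2.
      move=> ->; exists 0; split; first exact: X2.1.
        exact: linear_on0 X2 (@T_lin _ _).
      exact: linear_on0 X2 (@D_lin _ _).
    move=> [b [Xb Tb] Db]; have [e Xe Te] := T_exact mn Xb Tb.
    exists (D m.+1 e); split; [exact: D_X|by rewrite -DT// Te|exact: DD].
  have Xae : X m.+1 (a - e') by apply: subspaceB.
  exists w, 0; split; last by rewrite addr0.
    exists (a - e' - c).
      split; first by apply: subspaceB.
      rewrite (linear_onB X2 (@T_lin _ _))// (linear_onB X2 (@T_lin _ _))//.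
      by rewrite Ta w'E Te addrAC addrK subrr.
    rewrite (linear_onB X2 (@D_lin _ _))// (linear_onB X2 (@D_lin _ _))//.
    by rewrite Da De Dc !subr0.
  exact: (subspace_T_boundaries _ _).1.
Qed.

Lemma antidiagonal_iso k : (k <= n)%N ->
  subquotient_iso (@double_cycles (n - k) 0) (@total_boundaries (n - k) 0)
                  (@double_cycles n k) (@total_boundaries n k).
Proof.
move=> kn; suff H j : (j <= k)%N ->
    subquotient_iso (@double_cycles (n - k) 0) (@total_boundaries (n - k) 0)
      (@double_cycles (n - k + j) j) (@total_boundaries (n - k + j) j).
  by have := H k (leqnn k); rewrite subnK.
elim: j => [_|j IH jk].
  by rewrite addn0; apply/subquotient_iso_refl/subspace_double_cycles.
apply: subquotient_iso_trans (IH (ltnW jk)) _.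
rewrite addnS; apply/subquotient_iso_sym/antidiagonal_step.
by rewrite -[ltnRHS](subnK kn) ltn_add2l.
Qed.

Lemma total_boundaries_T m : @total_boundaries m 0 = @T_boundaries m 0.
Proof.
apply/seteqP; split=> [_ [_ [v [-> Tv ->]]]|v Tv]; first by rewrite add0r.
by exists 0, v; rewrite add0r.
Qed.

End DoubleComplex.

(** * The exterior derivative on a simplex *)

Section Differentiation.
Variables (R : realType) (V W : normedModType R).
Implicit Types (f g : V -> W).

Lemma derive_linear f g a x v : differentiable f x -> differentiable g x ->
  'D_v (fun y => a *: f y + g y) x = a *: 'D_v f x + 'D_v g x.
Proof.
move=> df dg; rewrite [LHS](@deriveD _ _ _ (a \*: f) g).
- by rewrite deriveZ//; apply: diff_derivable.
- exact/derivableZ/diff_derivable.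
- exact: diff_derivable.
Qed.

Lemma continuously_differentiable_linear r f g a :
  continuously_differentiable r f -> continuously_differentiable r g ->
  continuously_differentiable r (fun x => a *: f x + g x).
Proof.
elim: r f g => [|r IH] f g /=.
  move=> cf cg x; apply: (@continuousD _ _ _ (a \*: f) g); last exact: cg.
  by apply: continuousZl_tmp; exact: cf.
move=> [df cf] [dg cg]; split=> [x|v].
  by apply: (@differentiableD _ _ _ (a \*: f) g) => //; apply: differentiableZ.
have -> : (fun x => 'D_v (fun y => a *: f y + g y) x) =
    (fun x => a *: 'D_v f x + 'D_v g x).
  by apply: funext => x; apply: derive_linear.
by apply: IH; [apply: cf|apply: cg].
Qed.

Lemma smooth_differentiable f x : smooth f -> differentiable f x.
Proof. by move=> /(_ 1%N)[]. Qed.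

Lemma smooth_linear f g a :
  smooth f -> smooth g -> smooth (fun x => a *: f x + g x).
Proof. by move=> sf sg r; apply: continuously_differentiable_linear. Qed.

(** A derivative that is known to exist can be computed from one side. *)
Lemma derive_eq0_onesided f x v : derivable f x v -> f x = 0 ->
  (forall t, 0 < t -> t < 1 -> f (t *: v + x) = 0) -> 'D_v f x = 0.
Proof.
move=> df fx0 f0; rewrite /derive cvg_at_rightE//.
apply: lim_near_cst => //.
near=> t.
have t0 : 0 < t by near: t; apply: nbhs_right_gt.
have t1 : t < 1 by near: t; apply: nbhs_right_lt.
by rewrite /= fx0 f0// subr0 scaler0.
Unshelve. all: by end_near. Qed.

End Differentiation.

Section SimplexForms.
Variables (R : realType) (n : nat).
Implicit Types (C F : simplex R n) (x v t : pt R n) (k : nat).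

Lemma sum_delta C v (W : lmodType R) (f : pt R n -> W) : v \in C ->
  \sum_(u <- C) (u == v)%:R *: f u = f v.
Proof.
move=> vC; rewrite (bigD1_seq v vC (fset_uniq C))/= eqxx scale1r.
by rewrite big1 ?addr0// => u /negbTE->; rewrite scale0r.
Qed.

Lemma sum_delta1 C v : v \in C -> \sum_(u <- C) (u == v)%:R = 1 :> R.
Proof.
move=> vC; have := sum_delta (fun=> 1 : R^o) vC.
by under eq_bigr do rewrite /GRing.scale/= mulr1.
Qed.

Lemma body_star_shaped C x v (t : R) : body C x -> v \in C -> 0 < t -> t < 1 ->
  body C (t *: (v - x) + x).
Proof.
move=> [w [w_ge0 w_sum ->]] vC t0 t1.
exists (fun u => (1 - t) * w u + t * (u == v)%:R); split.
- move=> u uC; apply: addr_ge0; apply: mulr_ge0.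
  + by rewrite subr_ge0 ltW.
  + exact: w_ge0.
  + exact: ltW.
  + exact: ler0n.
- by rewrite big_split/= -!mulr_sumr w_sum (sum_delta1 vC) !mulr1 subrK.
under [RHS]eq_bigr do rewrite /= scalerDl -!scalerA.
rewrite big_split/= -!scaler_sumr (sum_delta id vC).
by rewrite scalerBr scalerBl scale1r addrC addrA addrAC.
Qed.

(** At [x], a tangent vector is a combination of the directions from [x] to the
    vertices, and these point into the simplex even when [x] lies on its
    boundary. *)
Lemma derive_tangent_eq0 C (f : pt R n -> R^o) x t : differentiable f x ->
  (forall y, body C y -> f y = 0) -> body C x -> tangent C t -> 'D_t f x = 0.
Proof.
move=> df f0 Cx [w [w0 ->]].
(* The weights of a tangent vector add up to zero. *)
have -> : \sum_(v <- C) w v *: v = \sum_(v <- C) w v *: (v - x).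
  under [RHS]eq_bigr do rewrite scalerBr.
  by rewrite sumrB -scaler_suml w0 scale0r subr0.
rewrite deriveE// raddf_sum big_seq big1//= => v vC.
rewrite linearZ/= -deriveE// derive_eq0_onesided ?scaler0//.
- exact: diff_derivable.
- exact: f0.
- by move=> h h0 h1; apply/f0/body_star_shaped.
Qed.

Lemma face_trans F G C : face F G -> face G C -> face F C.
Proof. by move=> /andP[F0 FG] /andP[_ GC]; rewrite /face F0 (fsubset_trans FG). Qed.

Lemma sum_fsubset F C (V : nmodType) (g : pt R n -> V) : (F `<=` C)%fset ->
  \sum_(v <- C) (if v \in F then g v else 0) = \sum_(v <- F) g v.
Proof.
move=> FC; rewrite -(big_fset_incl _ FC) => [|v _ /negbTE->//].
by rewrite big_seq [RHS]big_seq; apply: eq_bigr => v ->.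
Qed.

Lemma sum_fsubset_scale F C (w : pt R n -> R) : (F `<=` C)%fset ->
  \sum_(v <- C) (if v \in F then w v else 0) *: v = \sum_(v <- F) w v *: v.
Proof.
move=> FC; rewrite -(sum_fsubset _ FC); apply: eq_bigr => v _.
by case: ifP => // _; rewrite scale0r.
Qed.

Lemma body_face F C : face F C -> body F `<=` body C.
Proof.
move=> /andP[_ FC] _ [w [w_ge0 w_sum ->]].
exists (fun v => if v \in F then w v else 0); split.
- by move=> v _; case: ifP => // /w_ge0.
- by rewrite sum_fsubset.
- by rewrite sum_fsubset_scale.
Qed.

Lemma tangent_face F C : face F C -> tangent F `<=` tangent C.
Proof.
move=> /andP[_ FC] _ [w [w_sum ->]].
exists (fun v => if v \in F then w v else 0).
by rewrite sum_fsubset// sum_fsubset_scale.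
Qed.

Lemma trace_linear F k (a : R) (u v : kform R n k) :
  trace F (a *: u + v) = a *: trace F u + trace F v.
Proof.
apply: funext => x; apply: funext => V; rewrite /trace.
rewrite -[RHS]/(a * (if _ then _ else _) + (if _ then _ else _)).
by case: ifP => // _; rewrite mulr0 addr0.
Qed.

Lemma trace_lin_on F k (A : set (kform R n k)) : linear_on A (trace F).
Proof. by move=> a u v _ _; apply: trace_linear. Qed.

Lemma trace0 F k : trace F (0 : kform R n k) = 0.
Proof.
by have := trace_linear F (-1) (0 : kform R n k) 0; rewrite !scaleN1r !addNr.
Qed.

Lemma traceB F k (u v : kform R n k) : trace F (u - v) = trace F u - trace F v.
Proof. by rewrite addrC -scaleN1r trace_linear scaleN1r addrC. Qed.

Lemma trace_sum F k (I : Type) (r : seq I) (P : pred I) (f : I -> kform R n k) :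
  trace F (\sum_(i <- r | P i) f i) = \sum_(i <- r | P i) trace F (f i).
Proof.
apply: (big_morph (trace F)) => [u v|]; last exact: trace0.
by rewrite -[u]scale1r trace_linear !scale1r.
Qed.

Lemma trace_trace F C k (w : kform R n k) :
  face F C -> trace F (trace C w) = trace F w.
Proof.
move=> FC; apply: funext => x; apply: funext => V; rewrite /trace.
case: asboolP => // -[Fx FV]; case: asboolP => // -[]; split.
  exact: body_face FC _ Fx.
by move=> i; apply: tangent_face FC _ (FV i).
Qed.

Lemma smooth_form_linear k (a : R) (u v : kform R n k) :
  smooth_form _ u -> smooth_form _ v -> smooth_form _ (a *: u + v).
Proof.
move=> [au su] [av sv]; split; last first.
  by move=> V; apply: smooth_linear; [apply: su|apply: sv].
move=> x; rewrite -[(a *: u + v) x]/(fun V => a * u x V + v x V); split.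
  move=> A B C i b c hA hB hC.
  rewrite (proj1 (au x) A B C i b c)// (proj1 (av x) A B C i b c)//.
  by rewrite !mulrDr !mulrA [a * b]mulrC [a * c]mulrC addrACA.
by move=> A i j ij hA; rewrite (proj2 (au x) A i j)// (proj2 (av x) A i j)// mulr0 addr0.
Qed.

Lemma dform_linear k (a : R) (u v : kform R n k) :
  smooth_form _ u -> smooth_form _ v ->
  dform (a *: u + v) = a *: dform u + dform v.
Proof.
move=> [_ su] [_ sv]; apply: funext => x; apply: funext => V.
rewrite -[RHS]/(a * dform u x V + dform v x V) /dform mulr_sumr -big_split/=.
apply: eq_bigr => i _; rewrite mulrCA -mulrDr; congr (_ * _).
by rewrite -derive_linear//; apply: smooth_differentiable.
Qed.

Lemma row_row' m p i j (A : 'M[R]_(m, p)) : row j (row' i A) = row (lift i j) A.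
Proof. by apply/rowP => l; rewrite !mxE. Qed.

(** The exterior derivative on a simplex does not depend on the extension: the
    difference of two extensions vanishes on the simplex, hence so do its
    tangential derivatives. *)
Lemma dCE C k (e w : kform R n k) :
  smooth_form _ e -> trace C e = w -> dC C w = trace C (dform e).
Proof.
move=> se ew; rewrite /dC.
have [se' ew'] := @xgetPex _ 0 [set e | smooth_form _ e /\ trace C e = w]
  (ex_intro _ e (conj se ew)).
move: (xget _ _) se' ew' => e' se' e'w.
pose g := -1 *: e' + e.
have sg : smooth_form _ g by exact: smooth_form_linear.
suff gd : trace C (dform g) = 0.
  move/eqP: gd; rewrite dform_linear// trace_linear scaleN1r addrC subr_eq0.
  by move=> /eqP.
have g0 : trace C g = 0 by rewrite trace_linear e'w ew scaleN1r addNr.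
apply: funext => x; apply: funext => V; rewrite /trace; case: asboolP => // -[Cx CV].
rewrite /dform big1// => i _.
suff -> : 'D_(row i V) (fun y => g y (row' i V) : R^o) x = 0 by rewrite mulr0.
apply: derive_tangent_eq0 Cx (CV i).
  by apply: smooth_differentiable; apply: sg.2.
move=> y Cy; have := congr1 (fun h : kform R n k => h y (row' i V)) g0.
by rewrite /trace; case: asboolP => // -[]; split=> // j; rewrite (row_row' i j V).
Qed.

Lemma dC_linear C k : linear_on (smooth_forms C k) (dC C).
Proof.
move=> a _ _ [u su <-] [v sv <-].
rewrite (dCE su erefl) (dCE sv erefl) -trace_linear.
rewrite (dCE (smooth_form_linear a su sv) erefl) dform_linear//.
by rewrite trace_linear.
Qed.

Lemma trace_dC F C k (w : kform R n k) : face F C -> smooth_forms C k w ->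
  trace F (dC C w) = dC F (trace F w).
Proof.
move=> FC [e se <-]; rewrite (dCE se erefl) !trace_trace//.
by rewrite -(dCE se erefl).
Qed.

Lemma trace_one F C : face F C -> trace F (one_on C) = one_on F.
Proof. exact: trace_trace. Qed.

Lemma scale_one_on_eq0 C (a : R) : C != fset0 -> a *: one_on C = 0 -> a = 0.
Proof.
case/fset0Pn => v vC /(congr1 (fun h : kform R n 0 => h v 0)).
rewrite -[LHS]/(a * one_on C v 0) /one_on /trace; case: asboolP.
  by rewrite mulr1.
case; split; last by case.
exists (fun u => (u == v)%:R); split.
- by move=> u _; rewrite ler0n.
- exact: sum_delta1.
- by rewrite (sum_delta id vC).
Qed.

End SimplexForms.

(** * Incidence signs *)

(** Adjacent transpositions act transitively on the orderings of a sequence. *)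
Lemma adjacent_swap_ind (A : eqType) (P : seq A -> Prop) :
  (forall s t x y, P (s ++ x :: y :: t) -> P (s ++ y :: x :: t)) ->
  forall s s', perm_eq s s' -> P s -> P s'.
Proof.
move=> Pswap.
have front s : forall p x t, P (p ++ s ++ x :: t) -> P (p ++ x :: s ++ t).
  elim: s => // y s IH p x t; rewrite cat_cons -cat_rcons => /IH.
  by rewrite cat_rcons => /Pswap.
suff H s' : forall p s, perm_eq s s' -> P (p ++ s) -> P (p ++ s').
  by move=> s s' ss' Ps; apply: (H s' [::] s).
elim: s' => [p s /perm_size/size0nil->//|x s' IH p s ss'].
have xs : x \in s by rewrite (perm_mem ss') inE eqxx.
case/splitPr: xs ss' => s1 s2 ss' /front; rewrite -cat_rcons => /IH.
rewrite cat_rcons; apply.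
by rewrite -(perm_cons x) -(permPr ss') perm_sym -[x :: s2]cat1s perm_catCA.
Qed.

Section Signs.
Variables (R : realType) (n : nat).
Variable ori : simplex R n -> seq (pt R n) -> bool.
Implicit Types (F G C : simplex R n) (M : {fset simplex R n}).

Lemma perm_fset1U (v : pt R n) (s : seq (pt R n)) F :
  v \notin F -> perm_eq s F -> perm_eq (v :: s) (v |` F)%fset.
Proof.
move=> vF sF; apply: uniq_perm; rewrite ?fset_uniq//=.
  by rewrite (perm_mem sF) vF (perm_uniq sF) fset_uniq.
by move=> u; rewrite !inE (perm_mem sF).
Qed.

(** The sign may be computed from any ordering of the facet, not only from the
    enumeration that defines it: exchanging two neighbours reverses both
    orientations that are compared. *)
Lemma osign_ordering F v s : v \notin F -> perm_eq s F ->
  orientation F (ori F) -> orientation (v |` F)%fset (ori (v |` F)%fset) ->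
  osign ori F (v |` F)%fset =
    if ori (v |` F)%fset (v :: s) == ori F s then 1 else -1.
Proof.
move=> vF sF oF oC; rewrite /osign.
have -> : enum_fset ((v |` F) `\` F)%fset = [:: v].
  apply: perm_small_eq => //; apply: uniq_perm; rewrite ?fset_uniq//.
  move=> u; rewrite !inE; have [->|//] := eqVneq u v; first by rewrite vF.
  by rewrite /= andNb.
rewrite cat1s; set C := (v |` F)%fset.
pose P u := perm_eq u F /\
  (ori C (v :: u) == ori F u) = (ori C (v :: enum_fset F) == ori F (enum_fset F)).
have Pswap s' t x y : P (s' ++ x :: y :: t) -> P (s' ++ y :: x :: t).
  rewrite /P => -[st <-]; split.
    apply: perm_trans st; rewrite perm_cat2l.
    by rewrite (perm_catCA [:: y] [:: x] t).
  have vst : perm_eq (v :: s' ++ x :: y :: t) C by exact: perm_fset1U.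
  rewrite (oF _ _ _ _ st) -!cat_cons (oC (v :: s') _ _ _ vst).
  by case: (ori C _) (ori F _) => [] [].
have [] := adjacent_swap_ind Pswap (s := enum_fset F) (s' := s); last by move=> _ ->.
- by rewrite perm_sym.
- by split.
Qed.

(** Up to the orientations of the two facets, which cancel, one path gives the
    ordering y, x, G of the cell and the other one x, y, G. *)
Lemma osign_square G x y : x != y -> x \notin G -> y \notin G ->
  orientation G (ori G) -> orientation (x |` G)%fset (ori (x |` G)%fset) ->
  orientation (y |` G)%fset (ori (y |` G)%fset) ->
  orientation (y |` (x |` G))%fset (ori (y |` (x |` G))%fset) ->
  osign ori G (x |` G)%fset * osign ori (x |` G)%fset (y |` (x |` G))%fset +
  osign ori G (y |` G)%fset * osign ori (y |` G)%fset (y |` (x |` G))%fset = 0 :> R.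
Proof.
move=> xy xG yG oG ox oy oC.
have GG : perm_eq (enum_fset G) G by [].
have yxG : y \notin (x |` G)%fset by rewrite !inE negb_or eq_sym xy.
have xyG : x \notin (y |` G)%fset by rewrite !inE negb_or xy.
have EC : (y |` (x |` G))%fset = (x |` (y |` G))%fset by rewrite fsetUCA.
have oC' := oC; rewrite EC in oC'.
rewrite (osign_ordering xG GG oG ox) (osign_ordering yG GG oG oy).
rewrite (osign_ordering yxG (perm_fset1U xG GG) ox oC) EC.
rewrite (osign_ordering xyG (perm_fset1U yG GG) oy oC').
have := oC' [::] (enum_fset G) x y (perm_fset1U xyG (perm_fset1U yG GG)).
rewrite !cat0s => ->.
case: (ori _ (x :: y :: _)); case: (ori (x |` G)%fset _);
  case: (ori (y |` G)%fset _); case: (ori G _);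
  by rewrite /= ?mulr1 ?mul1r ?mulrN1 ?opprK ?subrr ?addNr.
Qed.

Lemma codim1_faceP F C : (F `<=` C)%fset -> #|` C| = #|` F|.+1 ->
  exists2 v, v \notin F & C = (v |` F)%fset.
Proof.
move=> FC cC.
have /cardfs1P[v CF] : #|` (C `\` F)%fset| == 1%N by rewrite cardfsDS// cC subSnn.
have CFE u : (u \notin F) && (u \in C) = (u == v) by rewrite -in_fsetD CF inE.
have /andP[vF vC] : (v \notin F) && (v \in C) by rewrite CFE.
exists v => //; apply/fsetP => u; rewrite !inE -CFE.
by have [/(fsubsetP FC)->//|] := boolP (u \in F); rewrite /= ?orbF.
Qed.

Lemma in_cells M p C : (C \in cells M p) = (C \in M) && (#|` C| == p).
Proof. by rewrite !inE. Qed.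

(** A face of codimension two lies in exactly two facets, with opposite signs. *)
Lemma osign_sum_eq0 M p G C : (forall F, F \in M -> orientation F (ori F)) ->
  (forall F, face G F -> face F C -> F \in M) ->
  G \in cells M p -> C \in cells M p.+2 -> face G C ->
  \sum_(F <- cells M p.+1 | proper_face G F && proper_face F C)
     osign ori G F * osign ori F C = 0 :> R.
Proof.
move=> oM convM; rewrite !in_cells => /andP[GM /eqP cG] /andP[CM /eqP cC].
move=> /andP[G0 GC].
have [x xC xG] : exists2 x, x \in C & x \notin G.
  have /fset0Pn[x] : (C `\` G)%fset != fset0.
    by rewrite -cardfs_gt0 cardfsDS// cC cG subSn// subSnn.
  by rewrite inE => /andP[]; exists x.
have xGC : (x |` G `<=` C)%fset by rewrite fsubUset fsub1set xC.
have cxG : #|` (x |` G)%fset| = p.+1 by rewrite cardfsU1 xG cG.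
have [|y yxG CE] := codim1_faceP xGC; first by rewrite cC cxG.
have [yx yG] : y != x /\ y \notin G by move: yxG; rewrite !inE negb_or => /andP[].
have yGC : (y |` G `<=` C)%fset.
  by rewrite CE fsubUset fsub1set !inE eqxx/= fsetUA fsubsetUr.
have cyG : #|` (y |` G)%fset| = p.+1 by rewrite cardfsU1 yG cG.
have faces v : v \notin G -> (v |` G `<=` C)%fset ->
    proper_face G (v |` G)%fset && proper_face (v |` G)%fset C.
  move=> vG vGC; rewrite /proper_face /face G0 vGC fsubsetU1 /=.
  have -> : (v |` G)%fset != fset0 by apply/fset0Pn; exists v; rewrite !inE eqxx.
  rewrite /=; apply/andP; split; apply/eqP => E.
    by move: vG; rewrite E !inE eqxx.
  by move: cC; rewrite -E cardfsU1 vG cG => /eqP; rewrite eqn_leq ltnn andbF.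
have inM v : v \notin G -> (v |` G `<=` C)%fset -> (v |` G)%fset \in M.
  by move=> vG vGC; have /andP[/andP[? _] /andP[? _]] := faces v vG vGC; apply: convM.
rewrite big_fset_condE.
have -> : [fset F in cells M p.+1 | proper_face G F && proper_face F C]%fset =
    ((x |` G) |` [fset (y |` G)])%fset :> {fset {fset pt R n}}.
  apply/fsetP => F; rewrite !inE.
  apply/idP/idP => [/and3P[/andP[FM /eqP cF] /andP[/andP[_ GF] _] /andP[/andP[_ FC] _]]|].
    have [|v vG FE] := codim1_faceP GF; first by rewrite cF cG.
    have : v \in C by apply: (fsubsetP FC); rewrite FE fset1U1.
    rewrite CE !inE (negbTE vG) orbF FE => /orP[]/eqP->; by rewrite eqxx ?orbT.
  case/orP=> /eqP->; rewrite faces// ?cxG ?cyG eqxx !andbT; exact: inM.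
rewrite big_fsetU1/=; last first.
  rewrite inE; apply: contraNneq xG => E.
  by have := fset1U1 x G; rewrite E !inE eq_sym (negbTE yx).
rewrite big_seq_fset1 CE; apply: osign_square => //; rewrite 1?eq_sym//.
- exact: oM.
- exact/oM/inM.
- exact/oM/inM.
- by apply: oM; rewrite -CE.
Qed.

End Signs.

(** * Relative homology on representatives *)

Lemma lspan_subspace (R : nzRingType) (V : lmodType R) (S : set V) :
  subspace S -> lspan S = S.
Proof.
move=> sS; apply/seteqP; split=> [_ [m [c [s [Ss ->]]]]|v Sv].
  by apply: subspace_sum => // i _; apply: subspaceZ.
exists 1%N, (fun=> 1), (fun=> v); split=> //.
by rewrite big_ord_recl big_ord0 scale1r addr0.
Qed.

Lemma qpi_linear (R : nzRingType) (V : lmodType R) (S : set V) a u v :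
  qpi S (a *: u + v) = a *: qpi S u + qpi S v.
Proof. by rewrite -qpi_add -qpi_scale. Qed.

Lemma qpi_eq0 (R : nzRingType) (V : lmodType R) (S : set V) u :
  subspace S -> qpi S u = 0 <-> S u.
Proof.
by move=> sS; rewrite -[0]/(qpi S 0) qpiE subr0 lspan_subspace.
Qed.

Section RelativeChains.
Variables (R : realType) (n : nat).
Variable ori : simplex R n -> seq (pt R n) -> bool.
Variables M N : {fset simplex R n}.
Hypothesis N_closed : forall F C, C \in N -> face F C -> F \in M -> F \in N.

Lemma boundary_linear p a (c d : chain M p.+1) :
  boundary ori (a *: c + d) = a *: boundary ori c + boundary ori d.
Proof.
apply/ffunP => F; rewrite !ffunE scaler_sumr -big_split/=.
apply: eq_bigr => C _; rewrite !ffunE mulrDr; congr (_ + _).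
exact: mulrCA.
Qed.

Lemma subspace_subchain p : subspace (subchain M N p).
Proof.
split=> [C _|a c d Nc Nd C CN]; rewrite !ffunE//.
by rewrite Nc// Nd// scaler0 addr0.
Qed.

Lemma boundary_subchain p (c : chain M p.+1) :
  subchain M N p.+1 c -> subchain M N p (boundary ori c).
Proof.
move=> Nc F FN; rewrite ffunE big1// => C /andP[FC _].
rewrite Nc ?mulr0//; apply: contra FN => CN; apply: N_closed CN FC _.
by have := valP F; rewrite in_cells => /andP[].
Qed.

Lemma rel_boundary_qpi p (c : chain M p.+1) :
  rel_boundary ori M N p (qpi _ c) = qpi _ (boundary ori c).
Proof.
apply/qpiE; rewrite lspan_subspace; last exact: subspace_subchain.
have -> : boundary ori (repr (qpi (subchain M N p.+1) c)) - boundary ori c =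
    boundary ori (repr (qpi (subchain M N p.+1) c) - c).
  by rewrite addrC -scaleN1r -boundary_linear scaleN1r addrC.
apply: boundary_subchain.
have := @repr_qpi _ _ (subchain M N p.+1) c.
by rewrite lspan_subspace//; exact: subspace_subchain.
Qed.

Lemma subspace_rel_boundaries p : subspace (range (rel_boundary ori M N p)).
Proof.
apply: subspace_image; first by split.
move=> a x y _ _; elim/qpi_ind: x => c; elim/qpi_ind: y => d.
by rewrite -qpi_linear !rel_boundary_qpi boundary_linear qpi_linear.
Qed.

Definition chain_class m (c : chain M m.+1) :
    quot (range (rel_boundary ori M N m.+1)) := qpi _ (qpi _ c).

(** Homology classes are handled through chains: cycles are the chains with
    boundary in [N], and a class vanishes if the chain is a boundary up to a
    chain in [N]. *)
Lemma homologyP m h : homology ori M N m h <->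
  exists2 c : chain M m.+1, subchain M N m (boundary ori c) & h = chain_class c.
Proof.
split=> [[z + <-]|[c Nc ->]].
  elim/qpi_ind: z => c /=; rewrite rel_boundary_qpi => bc; exists c => //.
  exact: (qpi_eq0 _ (subspace_subchain m)).1 bc.
exists (qpi _ c) => //=; rewrite rel_boundary_qpi.
exact: (qpi_eq0 _ (subspace_subchain m)).2 Nc.
Qed.

Lemma chain_class_eq0 m (c : chain M m.+1) : chain_class c = 0 <->
  exists y : chain M m.+2, subchain M N m.+1 (c - boundary ori y).
Proof.
rewrite qpi_eq0; last exact: subspace_rel_boundaries.
split=> [[x _]|[y cy]].
  elim/qpi_ind: x => y; rewrite rel_boundary_qpi => yc; exists y.
  have /qpiE := esym yc.
  by rewrite lspan_subspace//; exact: subspace_subchain.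
exists (qpi _ y) => //; rewrite rel_boundary_qpi; apply/esym/qpiE.
by rewrite lspan_subspace//; exact: subspace_subchain.
Qed.

End RelativeChains.

(** * Exactness with coefficients in a vector space *)

(** The pseudo-inverse of the matrix of [B], with its indices carried back to
    the finite types. *)
Lemma generalized_inverse (K : fieldType) (I L : finType) (B : I -> L -> K) :
  exists P : L -> I -> K, forall i l,
    \sum_i' (\sum_l' B i l' * P l' i') * B i' l = B i l.
Proof.
pose A := \matrix_(i < #|I|, l < #|L|) B (enum_val i) (enum_val l).
exists (fun l i => pinvmx A (enum_rank l) (enum_rank i)) => i l.
have /matrixP/(_ (enum_rank i) (enum_rank l)) := mulmxKpV (submx_refl A).
rewrite !mxE !enum_rankK => <-.
rewrite (reindex _ (onW_bij _ (@enum_val_bij I))) /=.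
apply: eq_bigr => i' _; rewrite !mxE enum_rankK; congr (_ * _).
rewrite (reindex _ (onW_bij _ (@enum_val_bij L))) /=.
by apply: eq_bigr => l' _; rewrite [A _ _]mxE enum_rankK !enum_valK.
Qed.

(** If [P] is a generalized inverse of [B], the rows of 1 - B P are cycles, hence
    boundaries; and [c] is the combination of these scalar cycles with
    coefficients [c i], because B P contributes nothing to it. *)
Lemma vector_exact (K : fieldType) (I J L : finType)
    (A : J -> I -> K) (B : I -> L -> K) :
  (forall x : I -> K, (forall l, \sum_i x i * B i l = 0) ->
     exists y : J -> K, forall i, x i = \sum_j y j * A j i) ->
  forall (V : lmodType K) (W : set V) (c : I -> V), subspace W ->
    (forall i, W (c i)) -> (forall l, \sum_i B i l *: c i = 0) ->
  exists b : J -> V,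
    (forall j, W (b j)) /\ (forall i, c i = \sum_j A j i *: b j).
Proof.
move=> exAB V W c sW Wc Bc.
have [P PE] := generalized_inverse B.
pose N i i' := (i == i')%:R - \sum_l B i l * P l i'.
have delta i l : \sum_i' (i == i')%:R * B i' l = B i l.
  rewrite (bigD1 i)//= eqxx mul1r big1 ?addr0// => i'.
  by rewrite eq_sym => /negbTE->; rewrite mul0r.
have /choice[S SE] i : exists y : J -> K, forall i', N i i' = \sum_j y j * A j i'.
  apply: exAB => l; under eq_bigr do rewrite mulrBl.
  by rewrite sumrB delta PE subrr.
exists (fun j => \sum_i S i j *: c i); split=> [j|i'].
  by apply: subspace_sum => // i _; apply: subspaceZ.
transitivity (\sum_i N i i' *: c i).
  under eq_bigr do rewrite scalerBl.
  rewrite sumrB [X in _ - X](_ : _ = 0) ?subr0.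
    rewrite (bigD1 i')//= eqxx scale1r big1 ?addr0// => i.
    by move=> /negbTE->; rewrite scale0r.
  under eq_bigr do rewrite scaler_suml.
  rewrite exchange_big/= big1// => l _.
  under eq_bigr do rewrite mulrC -scalerA.
  by rewrite -scaler_sumr Bc scaler0.
under eq_bigr do rewrite SE scaler_suml.
rewrite exchange_big/=; apply: eq_bigr => j _.
by rewrite scaler_sumr; apply: eq_bigr => i _; rewrite mulrC scalerA.
Qed.

(** * Patches *)

Definition extend0 (I : choiceType) (V : nmodType) (A : {fset I}) (f : A -> V)
    (x : I) : V :=
  if insub x is Some a then f a else 0.

Lemma extend0E (I : choiceType) (V : nmodType) (A : {fset I}) (f : A -> V) a :
  extend0 f (val a) = f a.
Proof. by rewrite /extend0 valK. Qed.

Lemma sum_extend0 (K : nzRingType) (I : choiceType) (V : lmodType K)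
    (A : {fset I}) (P : pred I) (g : I -> K) (f : A -> V) :
  \sum_(i : A) (if P (val i) then g (val i) else 0) *: f i =
  \sum_(x <- A | P x) g x *: extend0 f x.
Proof.
rewrite big_seq_fsetE/= [RHS]big_mkcond/=; apply: eq_bigr => i _.
by rewrite extend0E; case: ifP => // _; rewrite scale0r.
Qed.

Section Patches.
Variables (R : realType) (n : nat) (T U : {fset simplex R n}).
Variable ori : simplex R n -> seq (pt R n) -> bool.
Hypothesis T_face : forall C F, C \in T -> face F C -> F \in T.
Hypothesis U_face : forall C F, C \in U -> face F C -> F \in U.
Hypothesis T_pure : pure_dim n T.
Implicit Types (F G C D E : simplex R n) (m p : nat).

Local Notation TU := (T `\` U)%fset.

Lemma in_patchM F G : G \in patchM T F <->
  G \in T /\ exists D, [/\ D \in cells T n.+1, face F D & face G D].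
Proof.
rewrite !inE; split=> [/andP[GT /existsP[D /andP[FD GD]]]|[GT [D [DT FD GD]]]].
  by split=> //; exists (val D); split=> //; apply: valP.
apply/andP; split=> //; apply/existsP; exists [` DT]%fset.
by rewrite /= FD GD.
Qed.

Lemma in_skeleton (M : {fset simplex R n}) p G : G \in skeleton M p <->
  G \in M /\ exists2 E, E \in cells M p & face G E.
Proof.
rewrite !inE; split=> [/andP[GM /existsP[E GE]]|[GM [E EM GE]]].
  by split=> //; exists (val E) => //; apply: valP.
by apply/andP; split=> //; apply/existsP; exists [` EM]%fset.
Qed.

Lemma in_patchN F G : G \in Defs.patchN T U F <->
  G \in skeleton (patchM T F) n /\ (~~ face F G || (G \in U)).
Proof. by rewrite !inE; split=> /andP. Qed.

Lemma star_in_patchM F C : C \in T -> face F C -> C \in patchM T F.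
Proof.
move=> CT FC; apply/in_patchM; split=> //; have [D DT CD] := T_pure CT.
by exists D; split=> //; apply: face_trans FC CD.
Qed.

(** Removing from a top cell around [C] a vertex outside of [C] leaves a facet
    that contains [C]. *)
Lemma patchM_skeleton F C : (#|` C| <= n)%N -> C \in patchM T F ->
  C \in skeleton (patchM T F) n.
Proof.
move=> Cn CM; apply/in_skeleton; split=> //.
have /in_patchM[CT [D [DT FD /andP[C0 CD]]]] := CM.
move: (DT); rewrite in_cells => /andP[DT' /eqP cD].
have [v vD vC] : exists2 v, v \in D & v \notin C.
  have /fset0Pn[v] : (D `\` C)%fset != fset0.
    by rewrite -cardfs_gt0 cardfsDS// cD subn_gt0 ltnS.
  by rewrite inE => /andP[]; exists v.
have CE : (C `<=` D `\ v)%fset by rewrite fsubsetD1 CD.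
have E0 : (D `\ v)%fset != fset0.
  by apply: contraNneq C0 => E; move: CE; rewrite E fsubset0.
have ED : face (D `\ v)%fset D by rewrite /face E0 fsubD1set.
exists (D `\ v)%fset; last by rewrite /face C0.
rewrite in_cells; apply/andP; split.
  by apply/in_patchM; split; [apply: T_face ED|exists D].
by move: cD; rewrite (cardfsD1 v) vD add1n => -[->].
Qed.

Lemma patchN_closed F G C : C \in Defs.patchN T U F -> face G C ->
  G \in patchM T F -> G \in Defs.patchN T U F.
Proof.
move=> /in_patchN[/in_skeleton[_ [E EM CE]] FC] GC GM; apply/in_patchN; split.
  by apply/in_skeleton; split=> //; exists E => //; apply: face_trans CE.
case/orP: FC => [FC|CU]; last by rewrite (U_face CU GC) orbT.
by apply/orP; left; apply: contra FC => FG; apply: face_trans GC.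
Qed.

(** In degrees below n, the relative chains of the patch of [F] are the chains
    on the members of [T] outside [U] that contain [F].  In degree n the patch
    may also have cells in [U], but all their facets are in [U], so they bound
    nothing. *)
Lemma patch_exact F m (x : simplex R n -> R) :
  homology ori (patchM T F) (Defs.patchN T U F) m = [set 0] -> (m < n)%N ->
  (forall G, G \in cells TU m -> face F G ->
     \sum_(C <- cells TU m.+1 | proper_face G C) osign ori G C * x C = 0) ->
  exists y : simplex R n -> R, forall C, C \in cells TU m.+1 -> face F C ->
    x C = \sum_(E <- cells TU m.+2 | proper_face C E) osign ori C E * y E.
Proof.
set M := patchM T F; set N := Defs.patchN T U F => hom0 mn cyc.
have star C p : face F C -> (C \in cells TU p) = (C \in cells M p) && (C \notin U).
  move=> FC; rewrite !in_cells inE; have [CU|CU]/= := boolP (C \in U).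
    by rewrite andbF.
  rewrite andbT; congr (_ && _); apply/idP/idP => [CT|/in_patchM[]//].
  exact: star_in_patchM.
have outU G C : G \notin U -> face G C -> C \notin U.
  by move=> GU GC; apply: contra GU => CU; apply: U_face CU GC.
pose c : chain M m.+1 :=
  [ffun C => if face F (val C) && (val C \notin U) then x (val C) else 0].
have [|y cy] := (chain_class_eq0 ori (@patchN_closed F) c).1.
- have : homology ori M N m (chain_class ori N c); last by rewrite hom0.
  apply/homologyP; first exact: patchN_closed.
  exists c => // G GN; rewrite ffunE.
  have := valP G; rewrite in_cells => /andP[GM /eqP cG].
  have /andP[FG GU] : face F (val G) && (val G \notin U).
    move: GN; apply: contraNT; rewrite negb_and negbK => GN.
    apply/in_patchN; split=> //; apply: patchM_skeleton => //.
    by rewrite cG ltnW.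
  rewrite -[RHS](cyc (val G)) ?star ?GU ?andbT//; last exact: valP.
  pose h C := osign ori (val G) C * (if face F C && (C \notin U) then x C else 0).
  transitivity (\sum_(C <- cells M m.+1 | proper_face (val G) C) h C).
    by rewrite big_seq_fsetE/=; apply: eq_bigr => C _; rewrite ffunE.
  apply: eq_fbig_cond => [C|C _ /andP[GC _]].
    rewrite !inE/=; apply: andb_id2r => /andP[GC _].
    have := star C m.+1 (face_trans FG GC).
    by rewrite !inE (outU _ _ GU GC) andbT => ->.
  by rewrite /h (face_trans FG GC) (outU _ _ GU GC).
exists (extend0 y) => C CTU FC.
have := CTU; rewrite star// => /andP[CM CU].
have CN : C \notin N.
  by apply/negP => /in_patchN[_]; rewrite FC (negbTE CU).
have /eqP := cy [` CM]%fset CN.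
rewrite !ffunE subr_eq0 /= FC CU /= => /eqP ->.
transitivity (\sum_(E <- cells M m.+2 | proper_face C E) osign ori C E * extend0 y E).
  by rewrite big_seq_fsetE/=; apply: eq_bigr => E _; rewrite extend0E.
apply: eq_fbig_cond => [E|//].
rewrite !inE/=; apply: andb_id2r => /andP[CE _].
have := star E m.+2 (face_trans FC CE).
by rewrite !inE (outU _ _ CU CE) andbT => ->.
Qed.

(** The cycles to be bounded will be made of traces, with values in a space of
    bubbles.  The scalar statement is fed into [vector_exact] with the incidence
    matrices of the star of [F]. *)
Lemma patch_vector_exact F m (V : lmodType R) (W : set V)
    (c : simplex R n -> V) :
  homology ori (patchM T F) (Defs.patchN T U F) m = [set 0] -> (m < n)%N ->
  subspace W -> (forall C, C \in cells TU m.+1 -> face F C -> W (c C)) ->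
  (forall G, G \in cells TU m -> face F G ->
     \sum_(C <- cells TU m.+1 | proper_face G C) osign ori G C *: c C = 0) ->
  exists b : simplex R n -> V, (forall E, W (b E)) /\
    forall C, C \in cells TU m.+1 -> face F C ->
      c C = \sum_(E <- cells TU m.+2 | proper_face C E) osign ori C E *: b E.
Proof.
move=> hom0 mn sW Wc cyc.
pose star p := [fset C in cells TU p | face F C]%fset.
have in_star p C : (C \in star p) = (C \in cells TU p) && face F C.
  by rewrite !inE.
have starP p C : C \in star p -> C \in cells TU p /\ face F C.
  by rewrite in_star => /andP.
have star_sum p G (V' : lmodType R) (f : simplex R n -> V') : face F G ->
    \sum_(C <- cells TU p | proper_face G C) f C =
    \sum_(C <- star p | proper_face G C) f C.
  move=> FG; apply: eq_fbig_cond => // C; rewrite !inE/=.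
  by apply: andb_id2r => /andP[GC _]; rewrite (face_trans FG GC) andbT.
pose sgn C E : R := if proper_face C E then osign ori C E else 0.
pose A (j : cells TU m.+2) (i : star m.+1) := sgn (val i) (val j).
pose B (i : star m.+1) (l : star m) := sgn (val l) (val i).
have exAB (x : star m.+1 -> R) : (forall l, \sum_i x i * B i l = 0) ->
    exists y : cells TU m.+2 -> R, forall i, x i = \sum_j y j * A j i.
  move=> xB; have [|y yE] := patch_exact (x := @extend0 _ R^o _ x) hom0 mn.
    move=> G GTU FG; have GS : G \in star m by rewrite in_star GTU.
    rewrite -[RHS](xB [` GS]%fset) (star_sum _ _ R^o)//.
    rewrite -(@sum_extend0 _ _ R^o); apply: eq_bigr => C _.
    by rewrite mulrC.
  exists (fun j => y (val j)) => i.
  have [iC Fi] := starP _ _ (valP i).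
  rewrite -(@extend0E _ R^o _ x i) yE// big_seq_fsetE big_mkcond/=.
  by apply: eq_bigr => j _; rewrite [RHS]mulrC /A /sgn; case: ifP => // _; rewrite mul0r.
have [i|l|b [Wb bE]] := vector_exact exAB (c := fun i : star m.+1 => c (val i)) sW.
- by have [? ?] := starP _ _ (valP i); apply: Wc.
- have [lC Fl] := starP _ _ (valP l); rewrite -[RHS](cyc (val l))// star_sum//.
  rewrite big_seq_fsetE/= [RHS]big_mkcond/=; apply: eq_bigr => i _.
  by rewrite /B /sgn; case: ifP => // _; rewrite scale0r.
exists (extend0 b); split=> [E|C CTU FC].
  by rewrite /extend0; case: insubP => // _; exact: sW.1.
have CS : C \in star m.+1 by rewrite in_star CTU.
rewrite (bE [` CS]%fset) -sum_extend0; exact: eq_bigr.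
Qed.

End Patches.

(** * The double complex of piecewise forms *)

Section FormComplex.
Variables (R : realType) (n : nat) (T U : {fset simplex R n}).
Variable ori : simplex R n -> seq (pt R n) -> bool.
Variable Lambda : forall k : nat, simplex R n -> set (kform R n k).
Arguments Lambda : clear implicits.
Hypothesis complexT : simplicial_complex T.
Hypothesis pureT : pure_dim n T.
Hypothesis subU : subcomplex U T.
Hypothesis orientedT : oriented T ori.
Hypothesis formsT : form_spaces T Lambda.
Hypothesis exactT : local_exactness T U Lambda.
Hypothesis decompT : geometric_decomposition T Lambda.
Hypothesis patchT : local_patch ori T U.
Implicit Types (F G C D E : simplex R n) (m p k : nat).

Local Notation TU := (T `\` U)%fset.
Local Notation X := (Lambda_1 T U Lambda).
Local Notation "\D_( m )" := (Dop T U m) (at level 0, format "\D_( m )").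
Local Notation "\T_( m )" := (Top T U ori m) (at level 0, format "\T_( m )").

Lemma T_face C F : C \in T -> face F C -> F \in T.
Proof. by case: complexT => _ + _; apply. Qed.

Lemma U_face C F : C \in U -> face F C -> F \in U.
Proof. by case: subU => _ [_ + _]; apply. Qed.

Lemma T_neq0 C : C \in T -> C != fset0.
Proof. by case: complexT => + _ _ => /[apply] -[]. Qed.

Lemma face_refl C : C \in T -> face C C.
Proof. by move=> /T_neq0 C0; rewrite /face C0 fsubset_refl. Qed.

Lemma in_relcells p C :
  (C \in cells TU p) = [&& C \in T, C \notin U & #|` C| == p].
Proof. by rewrite in_cells inE; case: (C \in U); case: (C \in T). Qed.

Lemma relcellsT p C : C \in cells TU p -> C \in T.
Proof. by rewrite in_relcells => /and3P[]. Qed.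

Lemma subspace_Lambda k C : C \in T -> subspace (Lambda k C).
Proof.
case: formsT => + _ _ _ => /(_ k C)/[apply] -[_ [e ->]].
by split; [exact: lspan0|move=> a u v su sv; apply/lspanD/sv/lspanZ].
Qed.

Lemma Lambda_smooth k C : C \in T -> Lambda k C `<=` smooth_forms C k.
Proof. by case: formsT => + _ _ _ => /(_ k C)/[apply] -[]. Qed.

Lemma Lambda_dC k C w : C \in T -> Lambda k C w -> Lambda k.+1 C (dC C w).
Proof. by case: formsT => _ _ + _; apply. Qed.

Lemma Lambda_trace k C F w :
  C \in T -> face F C -> Lambda k C w -> Lambda k F (trace F w).
Proof.
by case: formsT => _ _ _ H CT FC Cw; rewrite -(H k C F CT FC); exists w.
Qed.

Lemma dC_lin k C : C \in T -> linear_on (Lambda k C) (dC C).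
Proof. by move=> /(@Lambda_smooth k)/linear_onS; apply; apply: dC_linear. Qed.

Lemma dC0 k C : C \in T -> dC C (0 : kform R n k) = 0.
Proof. by move=> CT; apply: linear_on0 (subspace_Lambda k CT) (dC_lin CT). Qed.

Lemma trace_self k C w : C \in T -> Lambda k C w -> trace C w = w.
Proof.
by move=> CT /(Lambda_smooth CT)[e _ <-]; rewrite trace_trace// face_refl.
Qed.

Lemma Lambda_1_at m k w C : X m k w -> C \in cells TU m.+1 -> Lambda k C (w C).
Proof. by move=> /(_ C); case: ifP. Qed.

Lemma Lambda_1_out m k w C : X m k w -> C \notin cells TU m.+1 -> w C = 0.
Proof. by move=> /(_ C); case: ifP. Qed.

Lemma subspace_Lambda_1 m k : subspace (X m k).
Proof.
split=> [C|a u v Xu Xv C].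
  by case: ifP => // /relcellsT/(subspace_Lambda k)[].
rewrite -[(a *: u + v) C]/(a *: u C + v C).
have := Xu C; have := Xv C; case: ifP => [/relcellsT CT Cv Cu|_ -> ->].
  exact: (subspace_Lambda k CT).2.
by rewrite scaler0 addr0.
Qed.

(** A spanning sequence is obtained by placing the spanning sequences of the
    spaces of forms at the respective cells. *)
Lemma Lambda_1_span m k : exists e : seq (kforms R n k), X m k `<=` seq_span e.
Proof.
have /choice[e eP] C : exists e : seq (kform R n k),
    C \in T -> Lambda k C `<=` seq_span e.
  have [CT|] := boolP (C \in T); last by exists [::].
  case: formsT => + _ _ _ => /(_ k C CT)[_ [e ->]]; exists e => _.
  exact: lspan_seq_span.
pose single C (w : kform R n k) : kforms R n k := fun D => if D == C then w else 0.
exists (flatten [seq map (single C) (e C) | C <- enum_fset (cells TU m.+1)]).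
have single_span C s w : seq_span s w -> seq_span (map (single C) s) (single C w).
  elim: s w => [_ ->|x s IH w [a /IH wa]].
    by apply: funext => D; rewrite /single; case: ifP.
  exists a; rewrite -[X in _ X](_ : single C (w - a *: x) = _)//.
  apply: funext => D.
  rewrite -[RHS]/(single C w D - a *: single C x D) /single.
  by case: ifP => // _; rewrite scaler0 subr0.
suff H l w : {subset l <= cells TU m.+1} -> uniq l ->
    (forall C, C \in l -> Lambda k C (w C)) -> (forall C, C \notin l -> w C = 0) ->
    seq_span (flatten [seq map (single C) (e C) | C <- l]) w.
  move=> w Xw; apply: H; [by []|exact: fset_uniq| |] => C.
    exact: Lambda_1_at.
  exact: Lambda_1_out.
elim: l w => [w _ _ _ w0|C l IH w lT /= /andP[Cl ul] wl w0].
  by apply: funext => C; rewrite w0.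
have -> : w = single C (w C) + (w - single C (w C)) by rewrite addrC subrK.
apply: seq_span_cat.
  apply/single_span/eP; first exact/relcellsT/lT/mem_head.
  exact/wl/mem_head.
have wE D : (w - single C (w C)) D = if D == C then 0 else w D.
  rewrite -[LHS]/(w D - single C (w C) D) /single.
  by case: eqP => [->|_]; rewrite ?subrr ?subr0.
apply: IH => // [D Dl|D Dl|D Dl].
- by apply: lT; rewrite inE Dl orbT.
- rewrite wE; case: eqP => [DC|_]; first by rewrite DC (negbTE Cl) in Dl.
  by apply: wl; rewrite inE Dl orbT.
- rewrite wE; case: eqP => // /eqP DC; apply: w0.
  by rewrite inE negb_or DC.
Qed.

Lemma Dop_lin m k : linear_on (X m k) (\D_(m)).
Proof.
move=> a u v Xu Xv; apply: funext => C.
rewrite -[RHS]/(a *: \D_(m) u C + \D_(m) v C) /Dop.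
case: ifP => [Cm|_]; last by rewrite scaler0 addr0.
by apply: dC_lin; [exact: relcellsT Cm|exact: Lambda_1_at Cm|exact: Lambda_1_at Cm].
Qed.

Lemma Top_linear m k a (u v : kforms R n k) :
  \T_(m) (a *: u + v) = a *: \T_(m) u + \T_(m) v.
Proof.
apply: funext => F; rewrite -[RHS]/(a *: \T_(m) u F + \T_(m) v F) /Top.
case: ifP => [Fm|_]; last by rewrite scaler0 addr0.
rewrite scaler_sumr -big_split/=; apply: eq_bigr => C _.
rewrite -[(a *: u + v) C]/(a *: u C + v C) trace_linear scalerDr.
by rewrite !scalerA [a * _]mulrC.
Qed.

Lemma Top_lin m k (A : set (kforms R n k)) : linear_on A (\T_(m)).
Proof. by move=> a u v _ _; apply: Top_linear. Qed.

Lemma Top0 k (w : kforms R n k) : \T_(0) w = 0.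
Proof.
apply: funext => F; rewrite /Top; case: ifP => //.
rewrite in_relcells => /and3P[/T_neq0].
by rewrite -cardfs_gt0 lt0n => /negbTE->.
Qed.

Lemma Dop_Lambda_1 m k w : X m k w -> X m k.+1 (\D_(m) w).
Proof.
move=> Xw C; case: ifP => Cm; rewrite /Dop Cm//.
by apply: Lambda_dC; [exact: relcellsT Cm|exact: Lambda_1_at Cm].
Qed.

Lemma Top_Lambda_1 m k w : X m.+1 k w -> X m k (\T_(m.+1) w).
Proof.
move=> Xw F; case: ifP => Fm; rewrite /Top Fm//.
have sF := subspace_Lambda k (relcellsT Fm).
rewrite big_seq_cond; apply: subspace_sum => // C /andP[Cm /andP[FC _]].
apply: subspaceZ => //; apply: Lambda_trace FC _; first exact: relcellsT Cm.
exact: Lambda_1_at Cm.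
Qed.

(** Traces commute with the exterior derivative. *)
Lemma Dop_Top m k w : X m.+1 k w -> \D_(m) (\T_(m.+1) w) = \T_(m.+1) (\D_(m.+1) w).
Proof.
move=> Xw; apply: funext => F; rewrite /Dop /Top; case: ifP => // Fm.
rewrite ?Fm.
have FT := relcellsT Fm.
rewrite big_seq_cond [RHS]big_seq_cond.
rewrite (@linear_on_sum _ _ _ _ _ _ _ _ _ _ (subspace_Lambda k FT) (dC_lin FT)).
  apply: eq_bigr => C /andP[Cm /andP[FC _]]; rewrite Cm; congr (_ *: _).
  by rewrite trace_dC//; apply: Lambda_smooth (relcellsT Cm) _ (Lambda_1_at Xw Cm).
move=> C /andP[Cm /andP[FC _]].
exact: Lambda_trace (relcellsT Cm) FC (Lambda_1_at Xw Cm).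
Qed.

(** After exchanging the sums, each codimension-two pair has coefficient zero;
    the facets in between are not in [U] since [U] is closed under faces. *)
Lemma Top_Top m k w : X m.+1 k w -> \T_(m) (\T_(m.+1) w) = 0.
Proof.
move=> Xw; apply: funext => G; rewrite {1}/Top; case: ifP => // Gm.
have -> : \sum_(F <- cells TU m.+1 | proper_face G F)
      osign ori G F *: trace G (\T_(m.+1) w F) =
    \sum_(F <- cells TU m.+1 | proper_face G F) \sum_(C <- cells TU m.+2)
      (if proper_face F C then osign ori G F * osign ori F C else 0) *:
        trace G (w C).
  rewrite big_seq_cond [RHS]big_seq_cond.
  apply: eq_bigr => F /andP[Fm /andP[GF _]]; rewrite /Top Fm.
  rewrite (@linear_on_sum _ _ _ setT (trace G)) //; last exact: trace_lin_on.
  rewrite scaler_sumr big_mkcond; apply: eq_bigr => C _.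
  case: ifP => FC; last by rewrite scale0r.
  by rewrite trace_trace// scalerA.
rewrite exchange_big/= big_seq big1// => C Cm.
rewrite -scaler_suml -big_mkcondr/=.
have [GC|GC] := boolP (face G C).
  rewrite (@osign_sum_eq0 _ _ _ TU _ _ _ _ _ Gm Cm GC) ?scale0r//.
    by move=> F; rewrite inE => /andP[_ FT]; apply: orientedT.1.
  move: Gm Cm; rewrite !in_relcells => /and3P[_ GU _] /and3P[CT _ _] F GF FC.
  rewrite inE (T_face CT FC) andbT; apply: contra GU => FU.
  exact: U_face FU GF.
rewrite big1 ?scale0r// => F /andP[/andP[GF _] /andP[FC _]].
by rewrite (face_trans GF FC) in GC.
Qed.

(** ** Columns *)

Lemma Lambda_top k m C w : C \in cells TU m.+1 -> (m <= k)%N ->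
  Lambda k.+1 C w -> w = 0.
Proof.
rewrite in_relcells => /and3P[CT _ /eqP cC] mk.
by case: formsT => _ + _ _ => ->//; rewrite cC ltnS.
Qed.

(** Part of local exactness up to the dimension of the cell, above which there
    are no forms. *)
Lemma Dop_Dop m k w : X m k w -> \D_(m) (\D_(m) w) = 0.
Proof.
move=> Xw; apply: funext => C; rewrite /Dop; case: ifP => // Cm; rewrite ?Cm.
have Lw := Lambda_1_at Xw Cm; have [km|mk] := ltnP k m.
  have [/(_ k km) dE _] := exactT Cm.
  by have : (dC C @` Lambda k C) (dC C (w C)) by [exists (w C)]; rewrite dE => -[].
by rewrite (Lambda_top Cm mk (Lambda_dC (relcellsT Cm) Lw)) dC0// (relcellsT Cm).
Qed.

Lemma Dop_exact m k w : X m k.+1 w -> \D_(m) w = 0 ->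
  exists2 a, X m k a & \D_(m) a = w.
Proof.
move=> Xw Dw.
have /choice[a aP] C : exists a : kform R n k,
    if C \in cells TU m.+1 then Lambda k C a /\ dC C a = w C else a = 0.
  have [Cm|/negbTE Cm] := boolP (C \in cells TU m.+1); rewrite ?Cm; last by exists 0.
  have Lw := Lambda_1_at Xw Cm; have CT := relcellsT Cm.
  have [km|mk] := ltnP k m; last first.
    exists 0; split; first exact: (subspace_Lambda k CT).1.
    by rewrite dC0// (Lambda_top Cm mk Lw).
  have [/(_ k km) dE _] := exactT Cm.
  have : [set w | Lambda k.+1 C w /\ dC C w = 0] (w C).
    by split=> //; have := congr1 (fun u => u C) Dw; rewrite /Dop Cm.
  by rewrite -dE => -[a La da]; exists a.
exists a.
  by move=> C; have := aP C; case: ifP => // _ [].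
apply: funext => C; rewrite /Dop; have := aP C; case: ifP => Cm; rewrite ?Cm.
  by case.
by move=> _; rewrite (Lambda_1_out Xw)// Cm.
Qed.

(** ** Rows *)

Lemma subspace_bubble k F : F \in T -> subspace (Lambda_bubble Lambda k F).
Proof.
move=> FT; have [L0 Ll] := subspace_Lambda k FT; split.
  by split=> // G _; rewrite trace0.
move=> a u v [Lu tu] [Lv tv]; split; first exact: Ll.
by move=> G GF; rewrite trace_linear tu// tv// scaler0 addr0.
Qed.

(** The traces on the faces [F] with [p] vertices are bubbles and form, for each
    [F], a relative cycle on the patch of [F]; the bounding chains, extended,
    remove these traces without disturbing those on smaller faces. *)
Lemma remove_traces m k p w : (m < n)%N -> X m k w -> \T_(m) w = 0 ->
  (forall C F, C \in cells TU m.+1 -> face F C -> (#|` F| < p)%N ->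
     trace F (w C) = 0) ->
  exists2 a, X m.+1 k a &
    forall C F, C \in cells TU m.+1 -> face F C -> (#|` F| <= p)%N ->
      trace F (w C - \T_(m.+1) a C) = 0.
Proof.
move=> mn Xw Tw wp.
have [ext [extL ext_id ext_face ext_off]] := decompT k.
have bubble C F : C \in cells TU m.+1 -> face F C -> #|` F| = p ->
    Lambda_bubble Lambda k F (trace F (w C)).
  move=> Cm FC cF; split.
    exact: Lambda_trace (relcellsT Cm) FC (Lambda_1_at Xw Cm).
  move=> G /andP[GF GneqF]; rewrite trace_trace//.
  apply: wp Cm (face_trans GF FC) _; rewrite -cF; apply: fproper_ltn_card.
  by rewrite fproperEneq GneqF; case/andP: GF.
have /choice[b bP] F : exists b : simplex R n -> kform R n k, F \in cells T p ->
    (forall E, Lambda_bubble Lambda k F (b E)) /\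
    forall C, C \in cells TU m.+1 -> face F C ->
      trace F (w C) =
        \sum_(E <- cells TU m.+2 | proper_face C E) osign ori C E *: b E.
  have [|] := boolP (F \in cells T p); last by exists (fun=> 0).
  rewrite in_cells => /andP[FT /eqP cF].
  have [|G Gm FG|b bP] := patch_vector_exact T_face U_face pureT
      (c := fun C => trace F (w C)) (patchT FT mn) mn (subspace_bubble k FT).
  - by move=> C Cm FC; apply: bubble.
  - have := congr1 (fun u : kforms R n k => trace F (u G)) Tw.
    rewrite /Top Gm [RHS]trace0 => tw; rewrite -[RHS]tw.
    rewrite (@linear_on_sum _ _ _ setT (trace F)) //; last exact: trace_lin_on.
    by apply: eq_bigr => C /andP[GC _]; rewrite trace_trace.
  - by exists b.
pose a : kforms R n k := fun E => if E \in cells TU m.+2 then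
  \sum_(F <- cells T p | face F E) ext F E (b F E) else 0.
have aX : X m.+1 k a.
  move=> E; rewrite /a; case: ifP => Em; rewrite ?Em//.
  have ET := relcellsT Em.
  rewrite big_seq_cond; apply: subspace_sum; first exact: subspace_Lambda.
  move=> F /andP[Fp FE]; have [bF _] := bP F Fp.
  by apply: (extL F E ET FE).1.
exists a => // C F0 Cm F0C cF0.
have CT := relcellsT Cm.
(* The extension from F to E has trace zero on C unless F is a face of C, in
   which case its trace is the extension to C; the sum over E then is the
   boundary of b F. *)
have TaC : \T_(m.+1) a C = \sum_(F <- cells T p | face F C) ext F C (trace F (w C)).
  rewrite /Top Cm.
  transitivity (\sum_(E <- cells TU m.+2 | proper_face C E)
      \sum_(F <- cells T p | face F C) osign ori C E *: ext F C (b F E)).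
    rewrite big_seq_cond [RHS]big_seq_cond; apply: eq_bigr => E /andP[Em /andP[CE _]].
    rewrite /a Em -scaler_sumr; congr (_ *: _).
    rewrite trace_sum.
    rewrite big_mkcond [RHS]big_mkcond big_seq [RHS]big_seq.
    apply: eq_bigr => F Fp; have [bF _] := bP F Fp.
    have [FC|FC] := boolP (face F C).
      by rewrite (face_trans FC CE) (ext_face _ _ _ _ (relcellsT Em) FC CE).
    by case: ifP => // FE; rewrite ext_off//; exact: relcellsT Em.
  rewrite exchange_big/= big_seq_cond [RHS]big_seq_cond.
  apply: eq_bigr => F /andP[Fp FC]; have [bF bE] := bP F Fp.
  have FT : F \in T by move: Fp; rewrite in_cells => /andP[].
  rewrite bE// (@linear_on_sum _ _ _ _ (ext F C) _ _ _ _ _ (subspace_bubble k FT))//.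
  exact: (extL F C CT FC).2.
rewrite TaC traceB.
have F0T := T_face CT F0C.
rewrite trace_sum big_seq_cond.
(* The extensions from other faces of the same size do not reach F0. *)
have off F : F \in cells T p -> face F C -> F != F0 ->
    trace F0 (ext F C (trace F (w C))) = 0.
  rewrite in_cells => /andP[FT /eqP cF] FC FF0.
  apply: ext_off => //; last exact: bubble.
  by apply: contra FF0 => /andP[_ FsF0]; rewrite eqEfcard FsF0/= cF.
have [cF0p|cF0p] := eqVneq #|` F0| p; last first.
  rewrite wp// ?ltn_neqAle ?cF0p// big1 ?subrr// => F /andP[Fp FC].
  apply: off => //; apply: contraNneq cF0p => <-.
  by move: Fp; rewrite in_cells => /andP[].
have F0p : F0 \in cells T p by rewrite in_cells F0T cF0p eqxx.
rewrite -big_seq_cond big_mkcond (bigD1_seq F0)/= ?fset_uniq// F0C.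
rewrite big_seq_cond big1 => [|F /andP[Fp FF0]]; last first.
  by case: ifP => // FC; apply: off.
rewrite addr0 ext_id ?subrr//; exact: bubble.
Qed.

Lemma Top_exact m k w : (m < n)%N -> X m k w -> \T_(m) w = 0 ->
  exists2 a, X m.+1 k a & \T_(m.+1) a = w.
Proof.
move=> mn Xw Tw.
(* A cell of dimension m has m.+1 vertices and is its own largest face. *)
suff [a Xa aP] : exists2 a, X m.+1 k a &
    forall C F, C \in cells TU m.+1 -> face F C -> (#|` F| < m.+2)%N ->
      trace F ((w - \T_(m.+1) a) C) = 0.
  exists a => //; apply/eqP; rewrite eq_sym -subr_eq0; apply/eqP/funext => C.
  have Xwa : X m k (w - \T_(m.+1) a).
    exact: (subspaceB (subspace_Lambda_1 m k) Xw (Top_Lambda_1 Xa)).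
  have [Cm|Cm] := boolP (C \in cells TU m.+1); last exact: Lambda_1_out Xwa Cm.
  have CT := relcellsT Cm.
  rewrite -(trace_self CT (Lambda_1_at Xwa Cm)) aP//; first exact: face_refl.
  by move: Cm; rewrite in_relcells => /and3P[_ _ /eqP->].
elim: m.+2 => [|p [a Xa aP]].
  by exists 0 => //; exact: (subspace_Lambda_1 _ _).1.
have XTa := Top_Lambda_1 Xa.
have [|||b Xb bP] := @remove_traces m k p (w - \T_(m.+1) a) mn.
- exact: (subspaceB (subspace_Lambda_1 m k) Xw XTa).
- rewrite (linear_onB (subspace_Lambda_1 m k) (@Top_lin m k _))//.
  by rewrite Tw Top_Top// subrr.
- exact: aP.
exists (a + b); first exact: (subspaceD (subspace_Lambda_1 m.+1 k) Xa Xb).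
move=> C F Cm FC cF; rewrite -[RHS](bP C F Cm FC)//; congr (trace F _).
rewrite -[a]scale1r Top_linear !scale1r opprD addrA //.
Qed.

(** ** Simplicial chains as piecewise constant functions *)

Definition chain_form p (c : chain T p) : kforms R n 0 := fun C =>
  if C \in U then 0 else (extend0 c C : R) *: one_on C.

Lemma chain_form_out p (c : chain T p) C : C \notin cells TU p ->
  chain_form c C = 0.
Proof.
rewrite in_relcells /chain_form; case: ifP => //= _ Cp.
by rewrite /extend0 insubN ?scale0r// in_cells.
Qed.

Lemma chain_form_in p (c : chain T p) C : C \in cells TU p ->
  chain_form c C = (extend0 c C : R) *: one_on C.
Proof. by rewrite in_relcells /chain_form => /and3P[_ /negbTE->]. Qed.

Lemma extend0_in p (c : chain T p) C (Cp : C \in cells T p) :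
  extend0 c C = c [` Cp]%fset.
Proof. exact: (extend0E c [` Cp]%fset). Qed.

Lemma chain_form_linear p a (c d : chain T p) :
  chain_form (a *: c + d) = a *: chain_form c + chain_form d.
Proof.
apply: funext => C.
rewrite -[RHS]/(a *: chain_form c C + chain_form d C) /chain_form.
case: ifP => // _; first by rewrite scaler0 addr0.
rewrite scalerA -scalerDl; congr (_ *: _).
rewrite /extend0; case: insubP => [? _ _|_]; last by rewrite mulr0 addr0.
by rewrite !ffunE.
Qed.

Lemma chain_form_eq0 p (c : chain T p) :
  chain_form c = 0 <-> subchain T U p c.
Proof.
split=> [c0 C CU|Uc].
  have := congr1 (fun u => u (val C)) c0.
  rewrite /chain_form (negbTE CU) extend0E; apply: scale_one_on_eq0.
  by apply: T_neq0; have := valP C; rewrite in_cells => /andP[].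
apply: funext => C; have [Cp|] := boolP (C \in cells TU p); last first.
  exact: chain_form_out.
rewrite chain_form_in//; move: Cp; rewrite in_relcells => /and3P[CT CU cC].
have Cp : C \in cells T p by rewrite in_cells CT.
by rewrite (extend0_in c Cp) Uc// scale0r.
Qed.

Lemma Top_chain_form m (c : chain T m.+1) :
  \T_(m) (chain_form c) = chain_form (boundary ori c).
Proof.
apply: funext => F; rewrite /Top; case: ifP => Fm; last first.
  by rewrite chain_form_out// Fm.
rewrite chain_form_in//; move: (Fm); rewrite in_relcells => /and3P[FT FU cF].
have Fm' : F \in cells T m by rewrite in_cells FT.
have -> : extend0 (boundary ori c) F =
    \sum_(C <- cells T m.+1 | proper_face F C) osign ori F C * extend0 c C.
  rewrite (extend0_in _ Fm') ffunE big_seq_fsetE/=.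
  by apply: eq_bigr => C _; rewrite extend0E.
rewrite scaler_suml.
transitivity (\sum_(C <- cells TU m.+1 | proper_face F C)
    (osign ori F C * extend0 c C) *: one_on F).
  rewrite big_seq_cond [RHS]big_seq_cond.
  apply: eq_bigr => C /andP[Cm /andP[FC _]]; rewrite chain_form_in//.
  rewrite -[_ *: one_on C]addr0 trace_linear trace0 addr0 trace_one//.
  by rewrite scalerA.
apply: eq_fbig_cond => // C; rewrite !inE/=; apply: andb_id2r => /andP[FC _].
case: (boolP (C \in U)) => // CU; by rewrite (U_face CU FC) in FU.
Qed.

Lemma one_on_span m C w : C \in cells TU m.+1 ->
  (Lambda 0 C w /\ dC C w = 0) <-> exists a, w = a *: one_on C.
Proof.
move=> Cm; have [_ kerE] := exactT Cm.
have -> : (Lambda 0 C w /\ dC C w = 0) = lspan [set one_on C] w.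
  by rewrite -kerE.
split=> [[p [c [s [sE ->]]]]|[a ->]].
  exists (\sum_(i < p) c i); rewrite scaler_suml.
  by apply: eq_bigr => i _; rewrite sE.
by apply: lspanZ; exists 1%N, (fun=> 1), (fun=> one_on C); split=> //;
  rewrite big_ord_recl big_ord0 scale1r addr0.
Qed.

(** By local exactness, the kernel of the exterior derivative consists of
    constants. *)
Lemma chain_form_surjective m w :
  (X m 0 w /\ \D_(m) w = 0) <-> exists c : chain T m.+1, w = chain_form c.
Proof.
split=> [[Xw Dw]|[c ->]].
  have /choice[a aE] C : exists a : R, C \in cells TU m.+1 -> w C = a *: one_on C.
    have [Cm|] := boolP (C \in cells TU m.+1); last by exists 0.
    have [a ->] : exists a, w C = a *: one_on C.
      apply/(one_on_span _ Cm); split; first exact: Lambda_1_at Xw Cm.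
      by have := congr1 (fun u => u C) Dw; rewrite /Dop Cm.
    by exists a.
  pose c : chain T m.+1 := [ffun C => a (val C)].
  exists c; apply: funext => C.
  have [Cm|Cm] := boolP (C \in cells TU m.+1); last first.
    by rewrite (Lambda_1_out Xw Cm) chain_form_out.
  have Cm' : C \in cells T m.+1.
    by move: Cm; rewrite in_relcells in_cells => /and3P[-> _].
  by rewrite chain_form_in// aE// (extend0_in c Cm') ffunE.
have cP C : C \in cells TU m.+1 ->
    Lambda 0 C (chain_form c C) /\ dC C (chain_form c C) = 0.
  move=> Cm; apply/(one_on_span _ Cm); rewrite chain_form_in//.
  by exists (extend0 c C).
split=> [C|].
  have [Cm|Cm] := boolP (C \in cells TU m.+1); rewrite ?Cm ?(negbTE Cm).
    by have [] := cP C Cm.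
  exact: chain_form_out.
apply: funext => C; rewrite /Dop; case: ifP => // Cm; rewrite ?Cm.
by have [] := cP C Cm.
Qed.

Local Notation cycles m j :=
  (@double_cycles R (kforms R n) X (@Dop R n T U) (@Top R n T U ori) m j).
Local Notation D_bounds m j :=
  (@D_boundaries R (kforms R n) X (@Dop R n T U) (@Top R n T U ori) m j).
Local Notation T_bounds m j :=
  (@T_boundaries R (kforms R n) X (@Dop R n T U) (@Top R n T U ori) m j).
Local Notation total_bounds m j :=
  (@total_boundaries R (kforms R n) X (@Dop R n T U) (@Top R n T U ori) m j).

(** A relative cycle and the family of constants given by its coefficients
    represent the same class. *)
Lemma homology_subquotient_iso m :
  subquotient_iso (homology ori T U m) [set 0] (cycles m 0) (T_bounds m 0).
Proof.
have Uc : forall F C, C \in U -> face F C -> F \in T -> F \in U.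
  by move=> F C CU FC _; apply: U_face CU FC.
exists (fun h w => exists c : chain T m.+1,
  [/\ subchain T U m (boundary ori c), h = chain_class ori U c & w = chain_form c]).
split.
- move=> a _ _ _ _ [c [bc -> ->]] [d [bd -> ->]]; exists (a *: c + d); split.
  + by rewrite boundary_linear; apply: (subspace_subchain T U m).2.
  + by rewrite /chain_class !qpi_linear.
  + by rewrite chain_form_linear.
- move=> h /(homologyP Uc)[c bc ->]; by exists (chain_form c), c.
- move=> w [Xw Tw Dw]; have [c wE] := (chain_form_surjective m w).1 (conj Xw Dw).
  exists (chain_class ori U c), c; split=> //.
  by apply/chain_form_eq0; rewrite -Top_chain_form -wE.
move=> _ _ [c [bc -> ->]]; split.
- by apply/(homologyP Uc); exists c.
- have [Xc Dc] := (chain_form_surjective m _).2 (ex_intro _ c erefl).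
  by split=> //; rewrite Top_chain_form; apply/chain_form_eq0.
have formB y : chain_form (c - boundary ori y) =
    chain_form c - chain_form (boundary ori y).
  by rewrite addrC -scaleN1r chain_form_linear scaleN1r addrC.
split=> [/(chain_class_eq0 ori Uc)[y /chain_form_eq0/eqP]|].
  rewrite formB subr_eq0 -Top_chain_form => /eqP->.
  by exists (chain_form y) => //; apply/chain_form_surjective; exists y.
move=> [_ /chain_form_surjective[y ->] cE]; apply/(chain_class_eq0 ori Uc).
exists y; apply/chain_form_eq0; rewrite formB -cE Top_chain_form.
exact: subrr.
Qed.

Variable ip : forall m k : nat, kforms R n k -> kforms R n k -> R.
Arguments ip : clear implicits.
Hypothesis scalar : forall m k, scalar_product (X m k) (ip m k).

Lemma cycles_Lambda_1 m k : cycles m k `<=` X m k.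
Proof. by move=> w []. Qed.

Lemma subspace_cycles m k : subspace (cycles m k).
Proof.
apply: subspace_double_cycles => *;
  [exact: subspace_Lambda_1|exact: Dop_lin|exact: Top_lin].
Qed.

Lemma harmonic_chains_iso m : subquotient_iso (cycles m 0) (T_bounds m 0)
  (harmonic_chains T U ori Lambda ip m) [set 0].
Proof.
have [e Xe] := Lambda_1_span m 0.
have -> : harmonic_chains T U ori Lambda ip m =
    [set w | cycles m 0 w /\ forall u, T_bounds m 0 u -> ip m 0%N w u = 0].
  by apply/seteqP; split=> w [[]]; [split|split].
apply: harmonic_subquotient_iso (subspace_Lambda_1 m 0) (scalar m 0) Xe _ _ _ _.
- exact: subspace_cycles.
- by apply: subspace_T_boundaries => *;
    [exact: subspace_Lambda_1|exact: Dop_lin|exact: Top_lin].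
- exact: cycles_Lambda_1.
- move=> _ [w [Xw Dw] <-]; split; [exact: Top_Lambda_1|exact: Top_Top|].
  by rewrite Dop_Top// Dw (linear_on0 (subspace_Lambda_1 _ _) (@Top_lin _ _ _)).
Qed.

Lemma harmonic_forms_iso k : subquotient_iso (cycles n k) (D_bounds n k)
  (harmonic_forms T U ori Lambda ip k) [set 0].
Proof.
have [e Xe] := Lambda_1_span n k.
have DT0 m j w : X m j w -> \T_(m) w = 0 -> \T_(m) (\D_(m) w) = 0.
  case: m => [|m] Xw Tw; first exact: Top0.
  by rewrite -Dop_Top// Tw (linear_on0 (subspace_Lambda_1 _ _) (@Dop_lin _ _)).
have -> : harmonic_forms T U ori Lambda ip k =
    [set w | cycles n k w /\ forall u, D_bounds n k u -> ip n k w u = 0].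
  apply/seteqP; split=> w.
    by case=> -[Xw Tw] Dw wo; split=> // u Du; apply: wo; case: (k) u Du.
  by case=> -[Xw Tw Dw] wo; split=> // u Du; apply: wo; case: (k) u Du.
apply: harmonic_subquotient_iso (subspace_Lambda_1 n k) (scalar n k) Xe _ _ _ _.
- exact: subspace_cycles.
- by apply: subspace_D_boundaries => *;
    [exact: subspace_Lambda_1|exact: Dop_lin|exact: Top_lin].
- exact: cycles_Lambda_1.
- case: (k) => [_ ->|j _ [w [Xw Tw] <-]] /=; first exact: (subspace_cycles n 0).1.
  by split; [exact: Dop_Lambda_1|exact: DT0|exact: Dop_Dop].
Qed.

(** In degree n there are no cells above, so the only boundaries are those
    coming from [D]. *)
Lemma total_boundaries_top k :
  total_bounds n k = D_bounds n k.
Proof.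
have T0 : T_bounds n k = [set 0].
  apply/seteqP; split=> [_ [w [Xw _] <-]|_ ->]; last first.
    exists 0; first split.
    + exact: (subspace_Lambda_1 _ _).1.
    + exact: linear_on0 (subspace_Lambda_1 n.+1 k) (@Dop_lin _ _).
    + exact: linear_on0 (subspace_Lambda_1 n.+1 k) (@Top_lin _ _ _).
  have -> : w = 0.
    apply: funext => C; apply: (Lambda_1_out Xw); rewrite in_relcells.
    apply/negP => /and3P[CT _ /eqP cC]; have [D + /andP[_ CD]] := pureT CT.
    rewrite in_cells => /andP[_ /eqP cD].
    by have := fsubset_leq_card CD; rewrite cC cD ltnn.
  exact: linear_on0 (subspace_Lambda_1 n.+1 k) (@Top_lin _ _ _).
apply/seteqP; split=> [_ [u [v [Du + ->]]]|u Du].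
  by rewrite T0 => ->; rewrite addr0.
by exists u, 0; rewrite T0 addr0.
Qed.

Lemma T_homology_D_cohomology_iso k : (k <= n)%N ->
  subquotient_iso (cycles (n - k) 0) (T_bounds (n - k) 0)
                  (cycles n k) (D_bounds n k).
Proof.
move=> kn; rewrite -total_boundaries_top -total_boundaries_T.
apply: antidiagonal_iso kn.
- exact: subspace_Lambda_1.
- exact: Dop_lin.
- by move=> m j; apply: Top_lin.
- exact: Dop_Lambda_1.
- exact: Top_Lambda_1.
- exact: Dop_Dop.
- exact: Top_Top.
- exact: Dop_Top.
- exact: Dop_exact.
- exact: Top_exact.
Qed.

End FormComplex.

Theorem corollary4p12 (R : realType) (n : nat)
  (T U : {fset simplex R n})
  (ori : simplex R n -> seq (pt R n) -> bool)
  (Lambda : forall k : nat, simplex R n -> set (kform R n k))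
  (ip : forall m k : nat, kforms R n k -> kforms R n k -> R)
  (complexT : simplicial_complex T)
  (pureT : pure_dim n T)
  (subU : subcomplex U T)
  (orientedT : oriented T ori)
  (formsT : form_spaces T Lambda)
  (scalar : forall m k : nat,
     scalar_product (Lambda_1 T U Lambda m k) (ip m k))
  (exactT : local_exactness T U Lambda)
  (decompT : geometric_decomposition T Lambda)
  (patchT : local_patch ori T U) :
  forall k : nat, (k <= n)%N ->
    lin_iso (homology ori T U (n - k)) (harmonic_chains T U ori Lambda ip (n - k))
    /\
    lin_iso (harmonic_chains T U ori Lambda ip (n - k))
            (harmonic_forms T U ori Lambda ip k).
Proof.
move=> k kn.
have chains m := harmonic_chains_iso complexT subU orientedT formsT scalar m.
have forms := harmonic_forms_iso ori complexT formsT exactT scalar k.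
have middle := T_homology_D_cohomology_iso complexT pureT subU orientedT formsT
  exactT decompT patchT kn.
split; apply: subquotient_lin_iso.
- by apply: subquotient_iso_trans (chains _); apply: homology_subquotient_iso.
- apply: subquotient_iso_trans (subquotient_iso_sym (chains _)) _.
  exact: subquotient_iso_trans middle forms.
Qed.
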